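(* Let $\Sigma$ be a compact, oriented surface with boundary components $C_1,\ldots,C_n$, let $g$ be a Riemannian metric on $\Sigma$, and let $F\colon\Sigma\to\Sigma$ be an orientation-preserving diffeomorphism such that $\mathcal C(g,F^*g)$ is finite and $\mathcal C(g,F^*g)\subset\Sigma\setminus\partial\Sigma$. For $i=1,\ldots,n$, let $\nu_i$ be the outward unit normal along $C_i$ and $\tau_i$ the unit vector tangent to $C_i$ in the positive direction. Write the differential of $F$ along $C_i$, with respect to the frame $(\nu_i,\tau_i)$ in the source and the frame $(\nu_j,\tau_j)$ in the target, where $F(C_i)=C_j$, as $$\mathrm dF\big|_{C_i}=c_i\begin{pmatrix} a_i&0\\ b_i&1\end{pmatrix},\qquad a_i,c_i\colon C_i\to(0,\infty),\quad b_i\colon C_i\to\mathbb R$$ (where $(a_i,b_i)$ is never equal to $(1,0)$, since $F$ has no conformal points on $C_i$). Then for all $i=1,\ldots,n$ we have the equality $$w_i(g,F^*g)=w(a_i-1,b_i),$$ where $w(a_i-1,b_i)$ is the winding number of the curve $(a_i-1,b_i)\colon C_i\cong S^1\to\mathbb R^2\setminus\{0\}$ around the origin.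
   Context: All objects are smooth. The boundary components carry the orientation induced from $\Sigma$ (outward normal first), so $(\nu_i,\tau_i)$ is a positive $g$-orthonormal frame along $C_i$; the identification $C_i\cong S^1$ is orientation-preserving. Conformal points: a symmetric bilinear two-tensor field $h$ on $\Sigma$ is conformal to $g$ at $z\in\Sigma$ if there is $c\in\mathbb R$ with $h_z=c\,g_z$. The set of such points is denoted $\mathcal C(g,h)$. For $h=F^*g$ these are the conformal points of $F$. The bundle $E^a$: $E^a\subset\mathrm{End}(T\Sigma)$ is the rank-two real subbundle of endomorphisms which are symmetric with respect to $g$ and have zero trace. In a positive orthonormal basis of $T_z\Sigma$ its elements are the matrices $\begin{pmatrix} a&b\\ b&-a\end{pmatrix}$, $a,b\in\mathbb R$, and $E^a$ is oriented by declaring the coordinates $(a,b)$ to be positive. The section $H^a$: given $h$, let $H$ be the section of $\mathrm{End}(T\Sigma)$ defined by $g_z(u,H_zv)=h_z(u,v)$ for all $z\in\Sigma$, $u,v\in T_z\Sigma$, and let $H^a:=H-\frac{\mathrm{tr}\,H}{2}I$ be its trace-free part, a section of $E^a$ whose zero set is $\mathcal C(g,h)$. Winding numbers: if $\mathcal C(g,h)$ is finite and contained in $\Sigma\setminus\partial\Sigma$, then $w_i(g,h)\in\mathbb Z$ is the winding number, along $C_i$ traversed in its positive direction, of the nowhere vanishing section $H^a|_{C_i}$ of the oriented plane bundle $E^a|_{C_i}$ with respect to the nowhere vanishing section $R^i$, where $R^i(z)\in E^a_z$, $z\in C_i$, is the reflection of $T_z\Sigma$ along (i.e. fixing) the line $T_z\partial\Sigma$.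 *)

(* Defs.v *)
From mathcomp Require Import all_boot all_order all_algebra.
From mathcomp Require Import all_classical all_reals all_analysis.

Set Implicit Arguments.
Unset Strict Implicit.
Unset Printing Implicit Defensive.

Import Order.TTheory GRing.Theory Num.Theory.
Import numFieldNormedType.Exports.

Local Open Scope classical_set_scope.
Local Open Scope ring_scope.

(* A is meant to be open. *)
Fixpoint Ck (R : realType) (V W : normedModType R) (k : nat)
    (A : set V) (f : V -> W) : Prop :=
  match k with
  | 0 => forall x, A x -> {for x, continuous f}
  | k'.+1 => (forall x, A x -> differentiable f x) /\
             (forall v, Ck k' A (fun x => 'D_v f x))
  end.

(* Smoothness on an arbitrary subset A: near each point of A the map extends
   to a C^infinity map on an open set of the ambient space. *)
Definition smooth_on (R : realType) (V W : normedModType R)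
    (A : set V) (f : V -> W) : Prop :=
  forall x, A x -> exists (U : set V) (f' : V -> W),
    [/\ open U, U x, forall k, Ck k U f' & {in A `&` U, f' =1 f}].

(* The model is the left half-plane, so that at a boundary point the first
   basis vector points outward and (outward normal first) the second one is
   the positive direction of the boundary. *)
Definition halfplane (R : realType) : set 'cV[R]_2 := [set x | x 0 0 <= 0].

(* The differential at x of a map known on the half-plane near x; at points
   of the boundary line only increments within the half-plane are used, and
   they determine the matrix L. *)
Definition is_hdiff (R : realType) (f : 'cV[R]_2 -> 'cV[R]_2)
    (x : 'cV[R]_2) (L : 'M[R]_2) : Prop :=
  forall e : R, 0 < e ->
    \forall y \near within (@halfplane R) (nbhs x),
      `|f y - f x - L *m (y - x)| <= e * `|y - x|.

Definition hdiff (R : realType) (f : 'cV[R]_2 -> 'cV[R]_2) (x : 'cV[R]_2)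
  : 'M[R]_2 := xget 0 [set L | is_hdiff f x L].

(* chart_inv is only meaningful on chart_cod *)
Record chart (R : realType) (M : topologicalType) := Chart {
  chart_dom : set M;
  chart_cod : set 'cV[R]_2;
  chart_map :> M -> 'cV[R]_2;
  chart_inv : 'cV[R]_2 -> M;
  open_chart_dom : open chart_dom;
  open_chart_cod : exists2 U, open U & chart_cod = @halfplane R `&` U;
  chart_map_cod : forall p, chart_dom p -> chart_cod (chart_map p);
  chart_inv_dom : forall x, chart_cod x -> chart_dom (chart_inv x);
  chart_mapK : forall p, chart_dom p -> chart_inv (chart_map p) = p;
  chart_invK : forall x, chart_cod x -> chart_map (chart_inv x) = x;
  chart_map_continuous : {within chart_dom, continuous chart_map};
  chart_inv_continuous : {within chart_cod, continuous chart_inv} }.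

(* chart_at selects a chart around each point; tangent vectors at p are
   represented by their components in chart_at p (see below). *)
Record oriented_surface (R : realType) := OrientedSurface {
  surface_carrier :> topologicalType;
  atlas : set (chart R surface_carrier);
  chart_at : surface_carrier -> chart R surface_carrier;
  surface_hausdorff : hausdorff_space surface_carrier;
  surface_second_countable : @second_countable surface_carrier;
  chart_at_atlas : forall p, atlas (chart_at p);
  chart_at_dom : forall p, chart_dom (chart_at p) p;
  transition_smooth : forall phi psi, atlas phi -> atlas psi ->
    smooth_on (phi @` (chart_dom phi `&` chart_dom psi))
              (psi \o chart_inv phi);
  transition_oriented : forall phi psi, atlas phi -> atlas psi ->
    forall p, chart_dom phi p -> chart_dom psi p ->
      0 < \det (hdiff (psi \o chart_inv phi) (phi p)) }.

Definition boundary (R : realType) (S : oriented_surface R) : set S :=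
  [set p | chart_at p p 0 0 = 0].

Definition boundary_components (R : realType) (S : oriented_surface R)
    (n : nat) (C : 'I_n -> set S) : Prop :=
  injective C /\
  range C = [set connected_component (@boundary R S) p | p in @boundary R S].

(* Tangent vectors and tensors.  A tangent vector v at p is the column of its
   components in chart_at p, an endomorphism A of the tangent space is a
   matrix acting by v |-> A *m v, and a bilinear form h on it is its Gram
   matrix, with value (u^T *m h *m v) 0 0.  The chart chart_at p is positive,
   so orientations of the tangent space are read off from determinants.  Since
   chart_at p jumps with p, regularity of fields is expressed in fixed charts
   of the atlas through to_chart. *)

(* Change of components at p from chart_at p to phi *)
Definition to_chart (R : realType) (S : oriented_surface R)
    (phi : chart R S) (p : S) : 'M[R]_2 :=
  hdiff (phi \o chart_inv (chart_at p)) (chart_at p p).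

Definition form_in_chart (R : realType) (S : oriented_surface R)
    (h : S -> 'M[R]_2) (phi : chart R S) (p : S) : 'M[R]_2 :=
  (invmx (to_chart phi p))^T *m h p *m invmx (to_chart phi p).

Definition endo_in_chart (R : realType) (S : oriented_surface R)
    (A : S -> 'M[R]_2) (phi : chart R S) (p : S) : 'M[R]_2 :=
  to_chart phi p *m A p *m invmx (to_chart phi p).

Definition bilin (R : realType) (S : oriented_surface R)
    (h : S -> 'M[R]_2) (p : S) (u v : 'cV[R]_2) : R :=
  (u^T *m h p *m v) 0 0.

Definition riemannian_metric (R : realType) (S : oriented_surface R)
    (g : S -> 'M[R]_2) : Prop :=
  [/\ forall p, (g p)^T = g p,
      forall p v, v != 0 -> 0 < bilin g p v v
    & forall phi, atlas phi ->
        smooth_on (chart_cod phi) (form_in_chart g phi \o chart_inv phi)].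

Definition smooth_map (R : realType) (S : oriented_surface R) (F : S -> S)
    : Prop :=
  continuous F /\
  forall phi psi, atlas phi -> atlas psi ->
    smooth_on (phi @` (chart_dom phi `&` F @^-1` chart_dom psi))
              (psi \o F \o chart_inv phi).

Definition diffeomorphism (R : realType) (S : oriented_surface R) (F : S -> S)
    : Prop :=
  smooth_map F /\
  exists G : S -> S, [/\ cancel F G, cancel G F & smooth_map G].

Definition tangent_map (R : realType) (S : oriented_surface R) (F : S -> S)
    (p : S) : 'M[R]_2 :=
  hdiff (chart_at (F p) \o F \o chart_inv (chart_at p)) (chart_at p p).

Definition orientation_preserving (R : realType) (S : oriented_surface R)
    (F : S -> S) : Prop := forall p, 0 < \det (tangent_map F p).

Definition pullback (R : realType) (S : oriented_surface R) (F : S -> S)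
    (h : S -> 'M[R]_2) (p : S) : 'M[R]_2 :=
  (tangent_map F p)^T *m h (F p) *m tangent_map F p.

Definition conformal_points (R : realType) (S : oriented_surface R)
    (g h : S -> 'M[R]_2) : set S :=
  [set p | exists c : R, h p = c *: g p].

Definition mx22 (R : realType) (a b c d : R) : 'M[R]_2 :=
  \matrix_(i, j) if i == 0 then (if j == 0 then a else b)
                 else (if j == 0 then c else d).

Definition frame (R : realType) (u v : 'cV[R]_2) : 'M[R]_2 :=
  mx22 (u 0 0) (v 0 0) (u 1 0) (v 1 0).

(* For p in the boundary: v is tangent to the boundary at p.  In chart_at p
   the boundary is the line where the first coordinate vanishes. *)
Definition tangent_to_boundary (R : realType) (v : 'cV[R]_2) : Prop :=
  v 0 0 = 0.

Definition outward (R : realType) (u : 'cV[R]_2) : Prop := 0 < u 0 0.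

(* orientation convention: outward normal first *)
Definition boundary_positive (R : realType) (v : 'cV[R]_2) : Prop :=
  tangent_to_boundary v /\ forall u, outward u -> 0 < \det (frame u v).

Definition outward_unit_normal (R : realType) (S : oriented_surface R)
    (g : S -> 'M[R]_2) (p : S) (nu : 'cV[R]_2) : Prop :=
  [/\ bilin g p nu nu = 1,
      forall v, tangent_to_boundary v -> bilin g p nu v = 0
    & outward nu].

Definition positive_unit_tangent (R : realType) (S : oriented_surface R)
    (g : S -> 'M[R]_2) (p : S) (tau : 'cV[R]_2) : Prop :=
  bilin g p tau tau = 1 /\ boundary_positive tau.

(* k is the winding number around the origin of the 1-periodic plane curve f:
   theta is a continuous determination of its angle. *)
Definition is_winding_number (R : realType) (f : R -> R * R) (k : int)
    : Prop :=
  exists theta : R -> R,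
    [/\ continuous theta,
        forall t, exists2 rho, 0 < rho &
          f t = (rho * cos (theta t), rho * sin (theta t))
      & theta 1 - theta 0 = 2 * pi * k%:~R].

Definition velocity (R : realType) (S : oriented_surface R) (gamma : R -> S)
    (t : R) : 'cV[R]_2 :=
  'D_1 (chart_at (gamma t) \o gamma : R^o -> 'cV[R]_2) t.

(* gamma, of period 1, identifies the circle R/Z with C, preserving
   orientations *)
Definition positive_parametrization (R : realType) (S : oriented_surface R)
    (C : set S) (gamma : R -> S) : Prop :=
  [/\ continuous gamma,
      forall phi, atlas phi ->
        smooth_on (gamma @^-1` chart_dom phi : set R^o) (phi \o gamma),
      forall t, gamma (t + 1) = gamma t,
      set_inj [set t | 0 <= t < 1] gamma /\ range gamma = C
    & forall t, boundary_positive (velocity gamma t)].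

Definition is_winding_along (R : realType) (S : oriented_surface R)
    (C : set S) (f : S -> R * R) (k : int) : Prop :=
  exists2 gamma, positive_parametrization C gamma &
    is_winding_number (f \o gamma) k.

(* The value 0 of xget is taken only if f has no winding number; k does not
   depend on the parametrization. *)
Definition winding (R : realType) (S : oriented_surface R)
    (C : set S) (f : S -> R * R) : int :=
  xget 0 [set k | is_winding_along C f k].

Definition in_Ea (R : realType) (S : oriented_surface R)
    (g : S -> 'M[R]_2) (p : S) (A : 'M[R]_2) : Prop :=
  (forall u v, bilin g p (A *m u) v = bilin g p u (A *m v)) /\ \tr A = 0.

(* the basis is formed by the columns of e *)
Definition positive_onb (R : realType) (S : oriented_surface R)
    (g : S -> 'M[R]_2) (p : S) (e : 'M[R]_2) : Prop :=
  e^T *m g p *m e = 1%:M /\ 0 < \det e.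

(* the coordinates (a, b) of an element with matrix (a b; b -a) in the basis
   e *)
Definition Ea_coords (R : realType) (e A : 'M[R]_2) : R * R :=
  let B := invmx e *m A *m e in (B 0 0, B 0 1).

(* E^a is oriented by the coordinates (a, b). *)
Definition Ea_positive_basis (R : realType) (S : oriented_surface R)
    (g : S -> 'M[R]_2) (p : S) (A B : 'M[R]_2) : Prop :=
  [/\ in_Ea g p A, in_Ea g p B & forall e, positive_onb g p e ->
    0 < (Ea_coords e A).1 * (Ea_coords e B).2
        - (Ea_coords e A).2 * (Ea_coords e B).1].

Definition continuous_endo_along (R : realType) (S : oriented_surface R)
    (C : set S) (A : S -> 'M[R]_2) : Prop :=
  forall phi, atlas phi ->
    {within C `&` chart_dom phi, continuous (endo_in_chart A phi)}.

(* The winding number along C of the section s of E^a with respect to the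
   nowhere vanishing section r: complete r to a continuous positive frame
   (r, r') of E^a along C, and take the winding number of the components of s
   in this frame. *)
Definition Ea_winding (R : realType) (S : oriented_surface R)
    (g : S -> 'M[R]_2) (C : set S) (s r : S -> 'M[R]_2) : int :=
  xget 0 [set k | exists (r' : S -> 'M[R]_2) (x y : S -> R),
    [/\ continuous_endo_along C r',
        forall p, C p -> Ea_positive_basis g p (r p) (r' p),
        forall p, C p -> s p = x p *: r p + y p *: r' p
      & is_winding_along C (fun p => (x p, y p)) k]].

(* g(u, H v) = h(u, v) *)
Definition sharp (R : realType) (S : oriented_surface R)
    (g h : S -> 'M[R]_2) (p : S) : 'M[R]_2 := invmx (g p) *m h p.

Definition Ha (R : realType) (S : oriented_surface R)
    (g h : S -> 'M[R]_2) (p : S) : 'M[R]_2 :=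
  sharp g h p - (\tr (sharp g h p) / 2)%:M.

(* For p in the boundary: the orthogonal reflection fixing the tangent line of
   the boundary, u |-> 2 g(v, u) / g(v, v) v - u with v spanning that line. *)
Definition boundary_reflection (R : realType) (S : oriented_surface R)
    (g : S -> 'M[R]_2) (p : S) : 'M[R]_2 :=
  let v : 'cV[R]_2 := delta_mx 1 0 in
  (2 / bilin g p v v) *: (v *m v^T *m g p) - 1%:M.

Definition w_boundary (R : realType) (S : oriented_surface R)
    (g h : S -> 'M[R]_2) (C : set S) : int :=
  Ea_winding g C (Ha g h) (boundary_reflection g).

(* Main.v *)
Require Import Defs.
From mathcomp Require Import all_boot all_order all_algebra.
From mathcomp Require Import all_classical all_reals all_analysis.
From mathcomp Require Import ring lra.

(** The formula [H^a = x R + y r'] expresses the section in a positive frame of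
    [E^a] along the boundary curve, and in the frame [(nu, tau)] everything is
    explicit.  Write [M = c (a 0; b 1)] for the matrix of [dF].  The matrix of
    [F^* g] is [M^T M], whose trace-free part has [E^a]-coordinates
    [(c^2 (a^2 + b^2 - 1) / 2, c^2 b)], while the reflection [R] along the
    tangent line is [diag (-1, 1)], with coordinates [(-1, 0)].  Relative to [R]
    and to the complement with coordinates [(0, -1)], the section therefore has
    the components [- c^2 ((a^2 + b^2 - 1) / 2, b)].  The sign and the factor
    [c^2] do not affect winding numbers, and since [a > 0] the curves
    [((a^2 + b^2 - 1) / 2, b)] and [(a - 1, b)] are never opposite: their second
    coordinates agree, and where these vanish the first ones have the same sign,
    by [a^2 - 1 = (a - 1) (a + 1)].  Curves that are never opposite have the
    same winding number (winding_number_not_opposite).  Another positive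
    complement [r'] of [R] only replaces [(x, y)] by a curve that is again never
    opposite to [- (a - 1, b)] (winding_components).

    Both sides of the theorem are integers selected from sets defined along
    positive parametrizations of the curve.  The comparison above works for
    each parametrization separately, so the two sets are shown to be equal, and
    no parametrization has to be constructed.

    What remains is regularity.  Winding numbers are compared by adding the
    angle between the two curves to a determination of the angle of the first,
    so [a], [b], [c] and the components of [r'] must be continuous along the
    curve.  The frame [(nu, tau)] is only given pointwise, in components that
    jump with the chart.  In a fixed chart, however, it is the lower triangular
    frame obtained from the Gram matrix of [g] by Gram-Schmidt, hence
    continuous (chart_frame_cvg): this requires that changes of charts preserve
    the boundary and the tangent direction to it (boundary_chart,
    to_chart_boundary).  The matrix of [dF] in these frames is then continuous
    by the chain rule for differentials on the half-plane
    (frame_tangent_map_cvg). *)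

Set Implicit Arguments.
Unset Strict Implicit.
Unset Printing Implicit Defensive.

Import Order.TTheory GRing.Theory Num.Theory.
Import numFieldNormedType.Exports.

Local Open Scope classical_set_scope.
Local Open Scope ring_scope.

(** * Matrices of order two *)

Section matrices_of_order_two.
Variable R : realType.
Implicit Types A B : 'M[R]_2.

Lemma ord2P (k : 'I_2) : k = 0 \/ k = 1.
Proof. by case: k => -[|[|//]] k2; [left|right]; exact/val_inj. Qed.

Lemma mul2E m n (A : 'M[R]_(m, 2)) (B : 'M[R]_(2, n)) i j :
  (A *m B) i j = A i 0 * B 0 j + A i 1 * B 1 j.
Proof.
rewrite mxE big_ord_recl big_ord1 (_ : lift ord0 ord0 = 1) //; exact/val_inj.
Qed.

Lemma det2E A : \det A = A 0 0 * A 1 1 - A 0 1 * A 1 0.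
Proof.
rewrite (expand_det_row _ 0) big_ord_recl big_ord1 /cofactor !det_mx11 !mxE /=.
rewrite (_ : lift 0 0 = 1); last exact/val_inj.
rewrite (_ : lift 1 0 = 0); last exact/val_inj.
by rewrite expr0 expr1 mul1r mulN1r mulrN.
Qed.

Lemma eq_mx22 A B : A 0 0 = B 0 0 -> A 0 1 = B 0 1 ->
  A 1 0 = B 1 0 -> A 1 1 = B 1 1 -> A = B.
Proof.
move=> h00 h01 h10 h11; apply/matrixP => i j.
by have [->|->] := ord2P i; have [->|->] := ord2P j.
Qed.

Lemma invmx2E A : A \in unitmx ->
  invmx A = mx22 (A 1 1 / \det A) (- A 0 1 / \det A)
                 (- A 1 0 / \det A) (A 0 0 / \det A).
Proof.
move=> uA; rewrite -[RHS]mul1mx -(mulVmx uA) -mulmxA -[LHS]mulmx1.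
move: uA; rewrite unitmxE unitfE => d0; congr (_ *m _).
by apply: eq_mx22; rewrite mul2E !mxE /= ?mulr1n ?mulr0n; move: d0;
  rewrite det2E => d0; field.
Qed.

(** When [D] expresses the map [L] in new components, obtained by [T1] in the
    source and [T2] in the target, both have the same matrix with respect to
    the frames [P1] and [P2]. *)
Lemma frame_change_map (T1 T2 D L P1 P2 : 'M[R]_2) :
  T2 \in unitmx -> P2 \in unitmx -> T2 *m L = D *m T1 ->
  invmx (T2 *m P2) *m D *m (T1 *m P1) = invmx P2 *m L *m P1.
Proof.
move=> uT uP TL; have uTP : T2 *m P2 \in unitmx by rewrite unitmx_mul uT.
apply: (can_inj (mulKmx uTP)); rewrite -(mulmxA (invmx _) D) mulKVmx //.
by rewrite -!mulmxA mulKVmx // (mulmxA D) -TL -mulmxA.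
Qed.

Lemma normr_entry_le m n (A : 'M[R]_(m, n)) i j :
  `|A i j| <= `|A|.
Proof.
rewrite [leRHS]/Num.norm /= mx_normrE.
by apply/bigmax_geP; right; exists (i, j).
Qed.

Lemma normr_mx_le m n (A : 'M[R]_(m, n)) (e : R) :
  0 <= e -> (forall i j, `|A i j| <= e) -> `|A| <= e.
Proof.
move=> e0 h; rewrite [leLHS]/Num.norm /= mx_normrE.
by apply/bigmax_leP; split=> // -[i j] _; exact: h.
Qed.

Lemma normr_mulmx_le (L : 'M[R]_2) (v : 'cV[R]_2) :
  `|L *m v| <= 2 * `|L| * `|v|.
Proof.
apply: normr_mx_le => [|i j]; first by rewrite !mulr_ge0.
rewrite mxE; apply: le_trans (ler_norm_sum _ _ _) _.
rewrite [leRHS](_ : _ = \sum_(k < 2) `|L| * `|v|); last first.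
  by rewrite sumr_const card_ord -[RHS]mulr_natl mulrA.
apply: ler_sum => k _; rewrite normrM.
by apply: ler_pM => //; exact: normr_entry_le.
Qed.

End matrices_of_order_two.

(** * Differentials on the half-plane *)

Lemma near_within (T : Type) (F : set_system T) (D P : set T) :
  Filter F -> F P -> within D F P.
Proof. by move=> FF; apply: filterS => y Py _. Qed.

Section half_plane_differential.
Variable R : realType.
Implicit Types (f g : 'cV[R]_2 -> 'cV[R]_2) (x v : 'cV[R]_2) (L : 'M[R]_2).
Local Notation H := (@halfplane R).

Lemma is_hdiff_near f g x L : H x ->
  (\forall y \near within H (nbhs x), f y = g y) ->
  is_hdiff f x L -> is_hdiff g x L.
Proof.
move=> Hx fg fL e e0; have fgx : f x = g x by exact: (nbhs_singleton fg).
by apply: filterS2 fg (fL _ e0) => y <-; rewrite fgx.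
Qed.

Lemma is_hdiff_lipschitz f x L : is_hdiff f x L ->
  \forall y \near within H (nbhs x), `|f y - f x| <= (1 + 2 * `|L|) * `|y - x|.
Proof.
move=> fL; apply: filterS (fL _ ltr01) => y fy.
rewrite -[f y - f x](subrK (L *m (y - x))) mulrDl.
exact: le_trans (ler_normD _ _) (lerD fy (normr_mulmx_le _ _)).
Qed.

Lemma is_hdiff_cvg f x L : is_hdiff f x L ->
  f y @[y --> within H (nbhs x)] --> f x.
Proof.
move=> fL; apply/cvgrPdist_le => e e0.
have K0 : 0 < 1 + 2 * `|L| by rewrite ltr_pwDl // mulr_ge0.
have small : \forall y \near within H (nbhs x), `|y - x| <= e / (1 + 2 * `|L|).
  have b : \forall y \near x, `|y - x| <= e / (1 + 2 * `|L|).
    apply: filterS (nbhsx_ballx x _ (divr_gt0 e0 K0)) => y.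
    by rewrite -ball_normE /= distrC => /ltW.
  exact: near_within b.
apply: filterS2 small (is_hdiff_lipschitz fL) => y y1 y2.
rewrite distrC (le_trans y2) // -ler_pdivlMl // mulrC //.
Qed.

Lemma is_hdiff_comp f g x L M :
  is_hdiff f x L -> is_hdiff g (f x) M ->
  (\forall y \near within H (nbhs x), H (f y)) ->
  is_hdiff (g \o f) x (M *m L).
Proof.
move=> fL gM Hf e e0.
set K := 1 + 2 * `|L|.
have K0 : 0 < K by rewrite ltr_pwDl // mulr_ge0.
set K' := 1 + 2 * `|M|.
have K'0 : 0 < K' by rewrite ltr_pwDl // mulr_ge0.
have e1 : 0 < e / (2 * K) by rewrite divr_gt0 // mulr_gt0.
have e2 : 0 < e / (2 * K') by rewrite divr_gt0 // mulr_gt0.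
have gfy : \forall y \near within H (nbhs x),
    `|g (f y) - g (f x) - M *m (f y - f x)| <= e / (2 * K) * `|f y - f x|.
  have h : \forall y \near within H (nbhs x), H (f y) ->
    `|g (f y) - g (f x) - M *m (f y - f x)| <= e / (2 * K) * `|f y - f x|.
    exact: (is_hdiff_cvg fL (gM _ e1)).
  by apply: filterS2 h Hf => y; exact.
near=> y.
have h1 : `|g (f y) - g (f x) - M *m (f y - f x)| <= e / 2 * `|y - x|.
  apply: (le_trans (near gfy y _)) => //.
  have h := near (is_hdiff_lipschitz fL) y _.
  rewrite (_ : e / 2 * `|y - x| = e / (2 * K) * (K * `|y - x|)); last first.
    by field; rewrite gt_eqF.
  by rewrite ler_wpM2l ?(ltW e1) // h.
have h2 : `|M *m (f y - f x - L *m (y - x))| <= e / 2 * `|y - x|.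
  apply: le_trans (normr_mulmx_le _ _) _.
  have h : `|f y - f x - L *m (y - x)| <= e / (2 * K') * `|y - x|.
    exact: (near (fL _ e2) y _).
  rewrite (_ : e / 2 * `|y - x| = K' * (e / (2 * K') * `|y - x|)); last first.
    by field; rewrite gt_eqF.
  by rewrite ler_pM ?mulr_ge0 // /K' ler_wpDl.
rewrite /= (_ : _ - _ = (g (f y) - g (f x) - M *m (f y - f x)) +
  M *m (f y - f x - L *m (y - x))); last first.
  by rewrite [M *m (_ - L *m _)]mulmxBr mulmxA addrA subrK.
apply: le_trans (ler_normD _ _) _.
by rewrite [e]splitr mulrDl lerD.
Unshelve. all: by end_near. Qed.

Lemma cvg_ray x v : x + s *: v @[s --> 0^'+] --> x.
Proof.
rewrite -[X in _ --> X]addr0; apply: cvgD; first exact: cvg_cst.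
rewrite -[X in _ --> X](scale0r v); apply: cvgZr_tmp.
exact: cvg_at_right_filter.
Qed.

(** A direction [v] that stays in the half-plane for a short time is an
    admissible increment, so [f] determines [L *m v]. *)
Lemma is_hdiff_ray f x L v : H x -> is_hdiff f x L ->
  (\forall s \near 0^'+, H (x + s *: v)) ->
  forall e, 0 < e ->
  \forall s \near 0^'+, `|f (x + s *: v) - f x - s *: (L *m v)| <= s * e.
Proof.
move=> Hx fL Hv e e0.
have e1 : 0 < e / (1 + `|v|) by rewrite divr_gt0 // ltr_pwDl.
have := @cvg_ray x v _ (fL _ e1); rewrite /= nbhs_simpl /= => h.
near=> s.
have s0 : 0 < s by near: s; exact: nbhs_right_gt.
have := near h s _ (near Hv s _).
rewrite (addrC x) addrK -scalemxAr normrZ gtr0_norm // => h1.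
apply: le_trans (h1 _ _) _ => //.
rewrite mulrCA ler_pM2l // -mulrA ler_piMr ?(ltW e0) //.
by rewrite mulrC ler_pdivrMr ?ltr_pwDl // mul1r lerDr.
Unshelve. all: by end_near. Qed.

Lemma ray_halfplane x v : H x -> v 0 0 <= 0 ->
  \forall s \near 0^'+, H (x + s *: v).
Proof.
rewrite /halfplane /= => Hx v0; near=> s.
rewrite /= !mxE.
have s0 : 0 < s by near: s; exact: nbhs_right_gt.
by rewrite -[leRHS]addr0 lerD // mulr_ge0_le0 // ltW.
Unshelve. all: by end_near. Qed.

(** The directions [- e_0] and [e_1] stay in the half-plane from any of its
    points, and they span the plane. *)
Lemma is_hdiff_unique f x L M : H x ->
  is_hdiff f x L -> is_hdiff f x M -> L = M.
Proof.
move=> Hx fL fM.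
have inward v : v 0 0 <= 0 -> L *m v = M *m v.
  move=> v0; apply/eqP; rewrite -subr_eq0 -normr_le0.
  apply/ler_addgt0Pl => e e0; rewrite addr0.
  have e2 : 0 < e / 2 by rewrite divr_gt0.
  have Hv := ray_halfplane Hx v0.
  have /(filterI Hv) := is_hdiff_ray Hx fL Hv e2.
  move=> /(filterI (is_hdiff_ray Hx fM Hv e2)).
  move=> /(filterI (nbhs_right_gt 0)) /filter_ex[s] [/= s0 [hM [_ hL]]].
  rewrite -(ler_pM2l s0) -[X in X * `|_|](gtr0_norm s0) -normrZ.
  rewrite scalerBr -[X in `|X|](subrKA (f (x + s *: v) - f x)).
  rewrite -opprB; apply: le_trans (ler_normD _ _) _.
  by rewrite normrN [e]splitr mulrDr lerD.
have e1 : L *m (- delta_mx 0 0) = M *m (- delta_mx 0 0 : 'cV_2).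
  by apply: inward; rewrite !mxE /= oppr_le0.
have e2 : L *m delta_mx 1 0 = M *m (delta_mx 1 0 : 'cV_2).
  by apply: inward; rewrite !mxE.
move: e1; rewrite !mulmxN => /oppr_inj.
rewrite -!colE in e2 * => e1.
apply/matrixP => i j; case: (unliftP 0 j) => [k|] ->.
  move/matrixP/(_ i 0): e2; rewrite !mxE (ord1 k) (_ : lift 0 0 = 1) //.
  exact/val_inj.
by move/matrixP/(_ i 0): e1; rewrite !mxE.
Qed.

Lemma hdiffE f x L : H x -> is_hdiff f x L -> hdiff f x = L.
Proof.
move=> Hx fL; apply: (is_hdiff_unique Hx _ fL).
exact: (@xgetPex _ _ [set M | is_hdiff f x M] (ex_intro _ L fL)).
Qed.

Lemma is_hdiff_hdiff f x L : H x -> is_hdiff f x L -> is_hdiff f x (hdiff f x).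
Proof. by move=> Hx fL; rewrite (hdiffE Hx fL). Qed.

(** A map of the half-plane to itself that hits the boundary line at [x] has a
    maximum of its first coordinate there, so this coordinate cannot increase
    in any admissible direction. *)
Lemma is_hdiff_le0 f x L v : H x -> is_hdiff f x L ->
  (\forall y \near within H (nbhs x), H (f y)) -> f x 0 0 = 0 ->
  (\forall s \near 0^'+, H (x + s *: v)) -> (L *m v) 0 0 <= 0.
Proof.
move=> Hx fL Hf fx0 Hv; apply/ler_addgt0Pl => e e0; rewrite addr0.
have := @cvg_ray x v _ Hf; rewrite /= nbhs_simpl /= => /(filterI Hv).
move=> /(filterI (is_hdiff_ray Hx fL Hv e0)) /(filterI (nbhs_right_gt 0)).
move=> /filter_ex[s] [/= s0 [h1 [h2]]] /(_ h2).
rewrite /halfplane /= => h3.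
rewrite -(ler_pM2l s0).
have := le_trans (normr_entry_le _ 0 0) h1.
rewrite !mxE fx0 subr0 ler_norml => /andP[+ _].
lra.
Qed.

End half_plane_differential.

Lemma differentiable_is_hdiff (R : realType) (f : 'cV[R]_2 -> 'cV[R]_2) x :
  differentiable f x ->
  is_hdiff f x (\matrix_(i, j) ('D_(delta_mx j 0) f x) i 0).
Proof.
move=> df; set J := \matrix_(i, j) _.
have dJ v : 'd f x v = J *m v.
  rewrite [v in LHS]matrix_sum_delta linear_sum /=.
  apply/matrixP => i k; rewrite (ord1 k) summxE !mxE.
  apply: eq_bigr => j _; rewrite big_ord1 linearZ /= !mxE deriveE //.
  by rewrite mulrC.
have /eqaddoP dfx := diff_locally df.
move=> e e0; apply: near_within.
have cx : y - x @[y --> x] --> (0 : 'cV[R]_2).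
  rewrite -(subrr x).
  exact: (cvgB cvg_id (cvg_cst _)).
have := cx _ (dfx _ e0); rewrite /= nbhs_simpl /=.
by apply: filterS => y /=; rewrite !fctE /= subrK dJ opprD addrA.
Qed.

(** Near [x] the differentials of [f] are the Jacobian matrices of an extension
    of [f] across the boundary line, and those are continuous. *)
Lemma smooth_on_is_hdiff (R : realType) (A : set 'cV[R]_2)
    (f : 'cV[R]_2 -> 'cV[R]_2) x :
  @halfplane R x -> smooth_on A f ->
  (\forall y \near within (@halfplane R) (nbhs x), A y) ->
  exists D : 'cV[R]_2 -> 'M[R]_2,
    (forall i j, {for x, continuous (fun y => D y i j)}) /\
    \forall y \near within (@halfplane R) (nbhs x), is_hdiff f y (D y).
Proof.
move=> Hx sf nA.
have [U [f' [oU Ux /(_ 1%N) /= [df' cf'] ff']]] := sf x (nbhs_singleton nA Hx).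
exists (fun y => \matrix_(i, j) ('D_(delta_mx j 0) f' y) i 0); split.
  move=> i j; rewrite (_ : (fun y => _) =
    (fun M : 'cV_2 => M i 0) \o (fun y => 'D_(delta_mx j 0) f' y)); last first.
    by apply/funext => y /=; rewrite mxE.
  by apply: continuous_comp; [exact: cf'|exact: coord_continuous].
have nU : \forall y \near x, U y by exact: open_nbhs_nbhs.
have nn : \forall y \near x, \forall z \near y, (@halfplane R z -> A z) /\ U z.
  by apply: near_join; apply: filterI.
apply: filterS nn => y yA Hy.
have [_ Uy] := nbhs_singleton yA.
apply: (@is_hdiff_near _ f') => //; last exact/differentiable_is_hdiff/df'.
apply: filterS yA => z [zA Uz] Hz; apply: ff'.
by rewrite in_setI !mem_set //; exact: zA.
Qed.

(** * Charts and the boundary *)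

Section charts.
Variables (R : realType) (S : oriented_surface R).
Implicit Types (phi psi chi : chart R S) (p : S) (f : S -> S).
Local Notation H := (@halfplane R).

Lemma chart_map_halfplane phi p : chart_dom phi p -> H (phi p).
Proof.
by move=> /chart_map_cod; have [U _ ->] := open_chart_cod phi => -[].
Qed.

Lemma nbhs_chart_dom phi p : chart_dom phi p -> nbhs p (chart_dom phi).
Proof.
by move=> dp; apply: open_nbhs_nbhs; split=> //; exact: open_chart_dom.
Qed.

Lemma chart_continuous phi p : chart_dom phi p -> {for p, continuous phi}.
Proof.
move=> dp; have := @chart_map_continuous _ _ phi.
rewrite continuous_open_subspace; last exact: open_chart_dom.
by apply; rewrite inE.
Qed.

(** A chart covers the points of the half-plane that are close to its image of
    [p], and its inverse is continuous there. *)
Lemma chart_inv_near phi p (V : set S) : chart_dom phi p -> nbhs p V ->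
  \forall y \near within H (nbhs (phi p)),
    chart_cod phi y /\ V (chart_inv phi y).
Proof.
move=> dp Vp; have cp := chart_map_cod dp.
have ci : chart_inv phi y @[y --> within (chart_cod phi) (nbhs (phi p))] --> p.
  rewrite -[X in _ --> X](chart_mapK dp).
  by have /subspace_continuousP := @chart_inv_continuous _ _ phi; exact.
have nV : \forall y \near phi p, chart_cod phi y -> V (chart_inv phi y).
  exact: (ci _ Vp).
have [U oU codE] := open_chart_cod phi.
have nU : \forall y \near phi p, U y.
  by apply: open_nbhs_nbhs; split=> //; move: cp; rewrite codE => -[].
apply: filterS2 nU nV => y Uy Vy Hy.
have cy : chart_cod phi y by rewrite codE.
by split=> //; exact: Vy.
Qed.

Lemma chart_local_map_halfplane f phi psi p : chart_dom phi p ->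
  {for p, continuous f} -> chart_dom psi (f p) ->
  \forall y \near within H (nbhs (phi p)), H ((psi \o f \o chart_inv phi) y).
Proof.
move=> dp cf df.
have := chart_inv_near dp (cf _ (nbhs_chart_dom df)).
by apply: filterS => y [_] /= /chart_map_halfplane.
Qed.

Lemma chart_local_map_hdiff f phi psi p : chart_dom phi p ->
  {for p, continuous f} -> chart_dom psi (f p) ->
  smooth_on (phi @` (chart_dom phi `&` f @^-1` chart_dom psi))
            (psi \o f \o chart_inv phi) ->
  (forall i j, {for p, continuous (fun z =>
     hdiff (psi \o f \o chart_inv phi) (phi z) i j)}) /\
  is_hdiff (psi \o f \o chart_inv phi) (phi p)
    (hdiff (psi \o f \o chart_inv phi) (phi p)).
Proof.
move=> dp cf df sf; have Hp := chart_map_halfplane dp.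
have [D [cD hD]] : exists D : 'cV[R]_2 -> 'M[R]_2,
    (forall i j, {for phi p, continuous (fun y => D y i j)}) /\
    \forall y \near within H (nbhs (phi p)),
      is_hdiff (psi \o f \o chart_inv phi) y (D y).
  apply: smooth_on_is_hdiff sf _ => //.
  have nV : nbhs p (chart_dom phi `&` f @^-1` chart_dom psi).
    apply: filterI; first exact: nbhs_chart_dom.
    exact: (cf _ (nbhs_chart_dom df)).
  apply: filterS (chart_inv_near dp nV) => y [cy Vy].
  by exists (chart_inv phi y) => //; exact: chart_invK.
have Dp := nbhs_singleton hD Hp.
split; last exact: is_hdiff_hdiff Dp.
have near_eq : \forall z \near p,
    D (phi z) = hdiff (psi \o f \o chart_inv phi) (phi z).
  apply: filterS2 (nbhs_chart_dom dp) (chart_continuous dp hD) => z dz hz.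
  apply/esym/hdiffE.
    exact: chart_map_halfplane.
  by apply: hz; exact: chart_map_halfplane.
move=> i j; rewrite /prop_for /continuous_at -(nbhs_singleton near_eq).
have := continuous_comp (chart_continuous dp) (cD i j).
apply: cvg_trans; apply: near_eq_cvg.
by apply: filterS near_eq => z /= ->.
Qed.

(** The chain rule, read in charts. *)
Lemma hdiff_comp f1 f2 phi psi chi p L1 L2 : chart_dom phi p ->
  {for p, continuous f1} -> chart_dom psi (f1 p) ->
  is_hdiff (psi \o f1 \o chart_inv phi) (phi p) L1 ->
  is_hdiff (chi \o f2 \o chart_inv psi) (psi (f1 p)) L2 ->
  hdiff (chi \o (f2 \o f1) \o chart_inv phi) (phi p) = L2 *m L1.
Proof.
move=> dp cf df h1 h2; have Hp := chart_map_halfplane dp.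
apply: hdiffE => //.
have e1 : (psi \o f1 \o chart_inv phi) (phi p) = psi (f1 p).
  by rewrite /= chart_mapK.
rewrite -e1 in h2.
apply: is_hdiff_near (is_hdiff_comp h1 h2 _) => //; last first.
  exact: chart_local_map_halfplane.
have := chart_inv_near dp (cf _ (nbhs_chart_dom df)).
by apply: filterS => y [_ /= dy]; rewrite chart_mapK.
Qed.

Lemma transition_hdiff phi psi p : atlas phi -> atlas psi ->
  chart_dom phi p -> chart_dom psi p ->
  is_hdiff (psi \o chart_inv phi) (phi p)
    (hdiff (psi \o chart_inv phi) (phi p)).
Proof.
move=> aphi apsi dphi dpsi.
have [] := @chart_local_map_hdiff id phi psi p dphi _ dpsi _ => //.
exact: (transition_smooth aphi apsi).
Qed.

Lemma to_chart_det_gt0 phi p : atlas phi -> chart_dom phi p ->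
  0 < \det (to_chart phi p).
Proof.
move=> aphi dphi; apply: transition_oriented => //; first exact: chart_at_atlas.
exact: chart_at_dom.
Qed.

Lemma to_chart_unit phi p : atlas phi -> chart_dom phi p ->
  to_chart phi p \in unitmx.
Proof. by move=> ap dp; rewrite unitmxE unitfE gt_eqF // to_chart_det_gt0. Qed.

(** The definition of boundary points uses only the preferred chart.  If another
    chart sent [p] to an interior point of the half-plane, the first coordinate
    of the transition map would have an interior maximum there; the first row
    of its differential would vanish, against the positivity of its
    determinant. *)
Lemma boundary_chart phi p : atlas phi -> chart_dom phi p -> boundary p ->
  phi p 0 0 = 0.
Proof.
move=> aphi dphi bp; have Hp := chart_map_halfplane dphi.
apply/eqP; rewrite eq_le; apply/andP; split; first exact: Hp.
rewrite leNgt; apply/negP => lt0.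
have ap := chart_at_atlas p; have dp := chart_at_dom p.
have hd := transition_hdiff aphi ap dphi dp.
have := transition_oriented aphi ap dphi dp.
set L := hdiff _ _ in hd *.
have row0 (v : 'cV[R]_2) : (L *m v) 0 0 <= 0.
  apply: (is_hdiff_le0 Hp hd).
  - exact: (@chart_local_map_halfplane id).
  - by rewrite /= chart_mapK.
  - near=> s; rewrite /halfplane /= !mxE.
    have s0 : 0 < s by near: s; exact: nbhs_right_gt.
    have sv : s < (- phi p 0 0) / (1 + `|v 0 0|).
      by near: s; apply: nbhs_right_lt; rewrite divr_gt0 ?oppr_gt0 // ltr_pwDl.
    rewrite ltr_pdivlMr ?ltr_pwDl // in sv.
    have := ler_norm (v 0 0); rewrite -(ler_pM2l s0); lra.
rewrite det2E.
have := row0 (delta_mx 0 0); have := row0 (- delta_mx 0 0).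
have := row0 (delta_mx 1 0); have := row0 (- delta_mx 1 0).
rewrite !mul2E !mxE /= => h1 h2 h3 h4.
have -> : L 0 0 = 0 by lra.
have -> : L 0 1 = 0 by lra.
by rewrite !mul0r subrr ltxx.
Unshelve. all: by end_near. Qed.

(** Changes of charts preserve the boundary line, hence its tangent direction,
    the outward side and, having positive determinant, its orientation. *)
Lemma to_chart_boundary phi p : atlas phi -> chart_dom phi p -> boundary p ->
  [/\ to_chart phi p 0 1 = 0, 0 < to_chart phi p 0 0 & 0 < to_chart phi p 1 1].
Proof.
move=> aphi dphi bp.
have ap := chart_at_atlas p; have dp := chart_at_dom p.
have hd : is_hdiff _ _ (to_chart phi p) := transition_hdiff ap aphi dp dphi.
have := to_chart_det_gt0 aphi dphi.
have Hp := chart_map_halfplane dp.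
have row0 (v : 'cV[R]_2) : v 0 0 <= 0 -> (to_chart phi p *m v) 0 0 <= 0.
  move=> v0; apply: (is_hdiff_le0 Hp hd).
  - exact: (@chart_local_map_halfplane id).
  - by rewrite /= chart_mapK // boundary_chart.
  - exact: ray_halfplane.
rewrite det2E; set L := to_chart phi p in row0 *.
have := row0 (- delta_mx 0 0); have := row0 (delta_mx 1 0).
have := row0 (- delta_mx 1 0).
rewrite !mul2E !mxE /= => h1 h2 h3.
have L01 : L 0 1 = 0 by lra.
have L00 : 0 <= L 0 0 by lra.
rewrite L01 mul0r subr0 => d0.
have {}L00 : 0 < L 0 0.
  rewrite lt_neqAle L00 andbT; apply: contraTneq d0 => <-.
  by rewrite mul0r ltxx.
by split=> //; rewrite -(pmulr_rgt0 _ L00).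
Qed.

End charts.

Section surface_fields.
Variables (R : realType) (S : oriented_surface R).
Implicit Types (phi psi : chart R S) (p : S).

Lemma chart_hdiff (F : S -> S) phi psi p : smooth_map F ->
  atlas phi -> atlas psi -> chart_dom phi p -> chart_dom psi (F p) ->
  is_hdiff (psi \o F \o chart_inv phi) (phi p)
    (hdiff (psi \o F \o chart_inv phi) (phi p)).
Proof.
move=> [cF sF] aphi apsi dp dFp.
exact: (proj2 (chart_local_map_hdiff dp (cF p) dFp (sF _ _ aphi apsi))).
Qed.

Lemma chart_hdiff_continuous (F : S -> S) phi psi p i j : smooth_map F ->
  atlas phi -> atlas psi -> chart_dom phi p -> chart_dom psi (F p) ->
  {for p, continuous (fun z => hdiff (psi \o F \o chart_inv phi) (phi z) i j)}.
Proof.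
move=> [cF sF] aphi apsi dp dFp.
exact: (proj1 (chart_local_map_hdiff dp (cF p) dFp (sF _ _ aphi apsi))).
Qed.

Lemma to_chart_tangent_map (F : S -> S) phi psi p : smooth_map F ->
  atlas phi -> atlas psi -> chart_dom phi p -> chart_dom psi (F p) ->
  to_chart psi (F p) *m tangent_map F p =
  hdiff (psi \o F \o chart_inv phi) (phi p) *m to_chart phi p.
Proof.
move=> sF aphi apsi dp dFp; have cF := sF.1.
have ap := chart_at_atlas p; have dpp := chart_at_dom p.
have aF := chart_at_atlas (F p); have dF := chart_at_dom (F p).
have <- : hdiff (psi \o (F \o id) \o chart_inv (chart_at p)) (chart_at p p) =
    hdiff (psi \o F \o chart_inv phi) (phi p) *m to_chart phi p.
  apply: (hdiff_comp dpp _ _ (transition_hdiff ap aphi dpp dp)) => //.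
  exact: chart_hdiff.
apply/esym; apply: (@hdiff_comp _ _ F id _ (chart_at (F p)) _ _ _ _ dpp) => //.
- exact: cF.
- exact: chart_hdiff.
- exact: transition_hdiff.
Qed.

Lemma form_in_chart_continuous (g : S -> 'M[R]_2) phi p i j :
  smooth_on (chart_cod phi) (form_in_chart g phi \o chart_inv phi) ->
  chart_dom phi p -> {for p, continuous (fun z => form_in_chart g phi z i j)}.
Proof.
move=> sg dp.
have [U [f [oU Up /(_ 0%N) /= cf fg]]] := sg _ (chart_map_cod dp).
have nearfg : \forall z \near p, f (phi z) = form_in_chart g phi z.
  have nU : \forall z \near p, U (phi z).
    by apply: (chart_continuous dp); exact: open_nbhs_nbhs.
  apply: filterS2 (nbhs_chart_dom dp) nU => z dz Uz.
  by rewrite fg /= ?chart_mapK // in_setI !mem_set //; exact: chart_map_cod.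
rewrite /prop_for /continuous_at -(nbhs_singleton nearfg).
have cfij : {for phi p, continuous (fun y => f y i j)}.
  apply: (@continuous_comp _ _ _ f (fun M : 'M[R]_2 => M i j)); first exact: cf.
  exact: coord_continuous.
have := continuous_comp (chart_continuous dp) cfij.
apply: cvg_trans; apply: near_eq_cvg.
by apply: filterS nearfg => z /= ->.
Qed.

End surface_fields.

(** * Orthonormal frames along the boundary *)

Section frames.
Variables (R : realType) (S : oriented_surface R).
Implicit Types (g : S -> 'M[R]_2) (phi : chart R S) (p : S).

(** [h] is the Gram matrix of an inner product in components where the boundary
    is the line of vanishing first coordinate, and the columns of [P] are an
    orthonormal basis formed by an outward and a positive tangent vector. *)
Definition adapted_frame (h P : 'M[R]_2) : Prop :=
  [/\ P 0 1 = 0, 0 < P 0 0, 0 < P 1 1 & P^T *m h *m P = 1%:M].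

Lemma frame_adapted g p nu tau :
  outward_unit_normal g p nu -> positive_unit_tangent g p tau ->
  (g p)^T = g p -> adapted_frame (g p) (frame nu tau).
Proof.
move=> [nn orth out] [tt [tan pos]] gsym.
have tau1 : 0 < tau 1 0.
  have := pos (delta_mx 0 0); rewrite /outward det2E !mxE /= => /(_ ltr01).
  by rewrite mul1r mulr0 subr0.
have nt : bilin g p nu tau = 0 by exact: orth.
have g10 : g p 1 0 = g p 0 1 by rewrite -[in LHS]gsym mxE.
move: nn nt tt; rewrite /bilin !mul2E !mxE /= g10 => nn nt tt.
split.
- by rewrite mxE /= tan.
- by rewrite mxE.
- by rewrite mxE.
apply: eq_mx22; rewrite !mul2E !mxE /= ?g10 ?mulr1n ?mulr0n.
- by rewrite -nn; ring.
- by rewrite -nt; ring.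
- by rewrite -nt; ring.
- by rewrite -tt; ring.
Qed.

Lemma adapted_frame_to_chart g phi p P : atlas phi -> chart_dom phi p ->
  boundary p -> adapted_frame (g p) P ->
  adapted_frame (form_in_chart g phi p) (to_chart phi p *m P).
Proof.
move=> aphi dp bp [P01 P00 P11 PgP].
have [T01 T00 T11] := to_chart_boundary aphi dp bp.
have uT := to_chart_unit aphi dp.
split.
- by rewrite mul2E P01 T01 mulr0 mul0r addr0.
- by rewrite mul2E T01 mul0r addr0 mulr_gt0.
- by rewrite mul2E P01 mulr0 add0r mulr_gt0.
rewrite /form_in_chart trmx_mul -PgP -!mulmxA mulKmx // !mulmxA.
by rewrite -(mulmxA _ (to_chart phi p)^T) -trmx_mul mulVmx // trmx1 mulmx1.
Qed.

(** The adapted frame is the outcome of Gram-Schmidt applied to the tangent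
    vector [e_1] and then [e_0].  In particular it depends continuously on the
    Gram matrix. *)
Lemma adapted_frame_entries (h P : 'M[R]_2) : adapted_frame h P ->
  [/\ 0 < h 1 1, 0 < h 0 0 - h 0 1 ^+ 2 / h 1 1 &
   [/\ P 0 0 = (Num.sqrt (h 0 0 - h 0 1 ^+ 2 / h 1 1))^-1,
      P 1 1 = (Num.sqrt (h 1 1))^-1 &
      P 1 0 = - h 0 1 / h 1 1 * P 0 0]].
Proof.
move=> [P01 P00 P11 PhP].
have e11 : P 1 1 ^+ 2 * h 1 1 = 1.
  by move/matrixP/(_ 1 1): PhP; rewrite !mul2E !mxE /= P01 mulr1n => <-; ring.
have e01 : (P 0 0 * h 0 1 + P 1 0 * h 1 1) * P 1 1 = 0.
  by move/matrixP/(_ 0 1): PhP; rewrite !mul2E !mxE /= P01 mulr0n => <-; ring.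
have e10 : (P 0 0 * h 1 0 + P 1 0 * h 1 1) * P 1 1 = 0.
  by move/matrixP/(_ 1 0): PhP; rewrite !mul2E !mxE /= P01 mulr0n => <-; ring.
have e00 : P 0 0 ^+ 2 * h 0 0 + P 0 0 * P 1 0 * (h 0 1 + h 1 0)
    + P 1 0 ^+ 2 * h 1 1 = 1.
  by move/matrixP/(_ 0 0): PhP; rewrite !mul2E !mxE /= mulr1n => <-; ring.
have h11E : h 1 1 = (P 1 1)^-1 ^+ 2.
  have ne : P 1 1 ^+ 2 != 0 by rewrite expf_neq0 ?gt_eqF.
  by rewrite exprVn -[LHS](mulKf ne) e11 mulr1.
have h11 : 0 < h 1 1 by rewrite h11E exprn_gt0 // invr_gt0.
have P10 : P 1 0 = - h 0 1 / h 1 1 * P 0 0.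
  apply: (mulIf (_ : h 1 1 != 0)); first by rewrite gt_eqF.
  rewrite [RHS](_ : _ = - (P 0 0 * h 0 1)); last by field; rewrite gt_eqF.
  apply/eqP; rewrite -addr_eq0 addrC.
  by have /eqP := e01; rewrite mulf_eq0 (gt_eqF P11) orbF.
have h10 : P 0 0 * h 1 0 = P 0 0 * h 0 1.
  apply: (mulIf (_ : P 1 1 != 0)); first by rewrite gt_eqF.
  by have := e10; rewrite -e01 !mulrDl => /addIr.
have e0 : P 0 0 ^+ 2 * (h 0 0 - h 0 1 ^+ 2 / h 1 1) = 1.
  have h11' : h 1 1 != 0 by rewrite gt_eqF.
  have e : P 0 0 * P 1 0 * h 1 0 = P 0 0 * P 1 0 * h 0 1.
    by rewrite mulrAC h10 mulrAC.
  rewrite -e00 (mulrDr (P 0 0 * P 1 0)) e P10; field.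
  exact: h11'.
have dE : h 0 0 - h 0 1 ^+ 2 / h 1 1 = (P 0 0)^-1 ^+ 2.
  have ne : P 0 0 ^+ 2 != 0 by rewrite expf_neq0 ?gt_eqF.
  by rewrite exprVn -[LHS](mulKf ne) e0 mulr1.
split=> //; first by rewrite dE exprn_gt0 // invr_gt0.
split=> //.
- by rewrite dE sqrtr_sqr gtr0_norm ?invr_gt0 // invrK.
- by rewrite h11E sqrtr_sqr gtr0_norm ?invr_gt0 // invrK.
Qed.

Lemma adapted_frame_unit (h P : 'M[R]_2) : adapted_frame h P -> P \in unitmx.
Proof.
move=> [P01 P00 P11 _].
by rewrite unitmxE unitfE det2E P01 mul0r subr0 mulf_neq0 ?gt_eqF.
Qed.

End frames.

(** * Winding numbers of curves that are never opposite *)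

Section winding.
Variable R : realType.
Implicit Types (u v : R * R) (U V : R -> R * R).

(** By the case of equality in the Cauchy-Schwarz inequality, this says that [u]
    and [v] are nonzero and that [v] is not on the half-line opposite to [u]. *)
Definition not_opposite u v : Prop :=
  0 < Num.sqrt (u.1 ^+ 2 + u.2 ^+ 2) * Num.sqrt (v.1 ^+ 2 + v.2 ^+ 2)
      + (u.1 * v.1 + u.2 * v.2).

(** The signed angle in [(- pi, pi)] from [u] to [v]: half of it has tangent
    [sin / (1 + cos)], a formula that is continuous away from opposite
    vectors. *)
Definition angle_between u v : R :=
  2 * atan ((u.1 * v.2 - u.2 * v.1) /
    (Num.sqrt (u.1 ^+ 2 + u.2 ^+ 2) * Num.sqrt (v.1 ^+ 2 + v.2 ^+ 2)
      + (u.1 * v.1 + u.2 * v.2))).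

Lemma cos_sin_double_atan (x : R) :
  cos (2 * atan x) = (1 - x ^+ 2) / (1 + x ^+ 2) /\
  sin (2 * atan x) = 2 * x / (1 + x ^+ 2).
Proof.
have d : 1 + x ^+ 2 != 0 by rewrite gt_eqF // ltr_pwDl // sqr_ge0.
have c2 : cos (atan x) ^+ 2 = (1 + x ^+ 2)^-1.
  by rewrite cos_atan exprVn sqr_sqrtr // addr_ge0 // sqr_ge0.
have c0 : cos (atan x) != 0.
  by rewrite -sqrf_eq0 c2 invr_eq0.
have s : sin (atan x) = x * cos (atan x).
  by have := atanK x; rewrite /tan => {2}<-; rewrite divfK.
rewrite mulrC mulr_natr cos_mulr2n sin_mulr2n s.
split; first by rewrite c2; field.
rewrite (_ : cos (atan x) * (x * cos (atan x)) = x * cos (atan x) ^+ 2);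
  last by ring.
by rewrite c2; field.
Qed.

Lemma angle_betweenP (rho th : R) v : 0 < rho ->
  not_opposite (rho * cos th, rho * sin th) v ->
  exists2 rho', 0 < rho' &
    v = (rho' * cos (th + angle_between (rho * cos th, rho * sin th) v),
         rho' * sin (th + angle_between (rho * cos th, rho * sin th) v)).
Proof.
case: v => v1 v2 rho0; rewrite /not_opposite /angle_between /=.
set r := Num.sqrt (v1 ^+ 2 + v2 ^+ 2).
have r2 : r ^+ 2 = v1 ^+ 2 + v2 ^+ 2.
  by rewrite sqr_sqrtr // addr_ge0 // sqr_ge0.
have -> : Num.sqrt ((rho * cos th) ^+ 2 + (rho * sin th) ^+ 2) = rho.
  by rewrite !exprMn -mulrDr cos2Dsin2 mulr1 sqrtr_sqr gtr0_norm.
have r_ge0 : 0 <= r by exact: sqrtr_ge0.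
have cs := cos2Dsin2 th.
set c := cos th in cs *; set s := sin th in cs *.
(* The components of v in the basis rotated by th. *)
set p := c * v1 + s * v2; set q := c * v2 - s * v1.
have -> : rho * r + (rho * c * v1 + rho * s * v2) = rho * (r + p).
  by rewrite /p; ring.
have -> : rho * c * v2 - rho * s * v1 = rho * q by rewrite /q; ring.
rewrite pmulr_rgt0 // => rp0.
have pq : p ^+ 2 + q ^+ 2 = r ^+ 2.
  rewrite r2 /p /q -[RHS]mul1r -cs; ring.
have r0 : 0 < r.
  rewrite lt_neqAle r_ge0 andbT; apply/eqP => r0.
  move: pq rp0; rewrite -r0 expr0n /= add0r => pq.
  have : p ^+ 2 = 0.
    by apply/eqP; rewrite eq_le sqr_ge0 andbT -[leRHS]pq lerDl sqr_ge0.
  by move/eqP; rewrite sqrf_eq0 => /eqP ->; rewrite ltxx.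
have -> : rho * q / (rho * (r + p)) = q / (r + p).
  by rewrite -mulf_div divff ?mul1r // gt_eqF.
have [cd sd] := cos_sin_double_atan (q / (r + p)).
have den : 1 + (q / (r + p)) ^+ 2 = 2 * r / (r + p).
  have q2 : q ^+ 2 = r ^+ 2 - p ^+ 2 by rewrite -pq; ring.
  by rewrite expr_div_n q2; field; rewrite gt_eqF.
have num : 1 - (q / (r + p)) ^+ 2 = 2 * p / (r + p).
  have q2 : q ^+ 2 = r ^+ 2 - p ^+ 2 by rewrite -pq; ring.
  by rewrite expr_div_n q2; field; rewrite gt_eqF.
have rp' : r + p != 0 by rewrite gt_eqF.
have r' : r != 0 by rewrite gt_eqF.
move: cd sd; rewrite num den => cd sd.
have {}cd : r * cos (2 * atan (q / (r + p))) = p.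
  by rewrite cd; field; rewrite ?rp' ?r'.
have {}sd : r * sin (2 * atan (q / (r + p))) = q.
  by rewrite sd; field; rewrite ?rp' ?r'.
exists r => //; rewrite cosD sinD -/c -/s.
congr (_, _).
  rewrite (_ : r * _ = c * (r * cos (2 * atan (q / (r + p)))) -
    s * (r * sin (2 * atan (q / (r + p))))); last by ring.
  by rewrite cd sd /p /q -[LHS]mul1r -cs; ring.
rewrite (_ : r * _ = s * (r * cos (2 * atan (q / (r + p)))) +
  c * (r * sin (2 * atan (q / (r + p))))); last by ring.
by rewrite cd sd /p /q -[LHS]mul1r -cs; ring.
Qed.

Lemma not_opposite_sym u v : not_opposite u v -> not_opposite v u.
Proof.
by rewrite /not_opposite mulrC [u.1 * _]mulrC [u.2 * _]mulrC.
Qed.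

Definition continuous_pair U : Prop :=
  continuous (fun t => (U t).1) /\ continuous (fun t => (U t).2).

Lemma continuous_norm_pair U : continuous_pair U ->
  continuous (fun t => Num.sqrt ((U t).1 ^+ 2 + (U t).2 ^+ 2)).
Proof.
move=> [c1 c2] t.
apply: (@continuous_comp _ _ _ (fun t => (U t).1 ^+ 2 + (U t).2 ^+ 2)).
  by apply: cvgD; apply: cvgM; first [exact: c1|exact: c2].
exact: sqrt_continuous.
Qed.

Lemma angle_between_continuous U V : continuous_pair U -> continuous_pair V ->
  (forall t, not_opposite (U t) (V t)) ->
  continuous (fun t => angle_between (U t) (V t)).
Proof.
move=> cU cV UV t; have [cU1 cU2] := cU; have [cV1 cV2] := cV.
pose q t := ((U t).1 * (V t).2 - (U t).2 * (V t).1) /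
  (Num.sqrt ((U t).1 ^+ 2 + (U t).2 ^+ 2) *
   Num.sqrt ((V t).1 ^+ 2 + (V t).2 ^+ 2) +
   ((U t).1 * (V t).1 + (U t).2 * (V t).2)).
suff cq : {for t, continuous q}.
  have ca : {for t, continuous (atan \o q)}.
    by apply: continuous_comp => //; exact: continuous_atan.
  by apply: cvgM; [exact: cvg_cst|exact: ca].
apply: cvgM.
  by apply: cvgB; apply: cvgM; [exact: cU1|exact: cV2|exact: cU2|exact: cV1].
apply: cvgV; first by rewrite gt_eqF //; exact: UV.
apply: cvgD; first by apply: cvgM; exact: continuous_norm_pair.
by apply: cvgD; apply: cvgM; [exact: cU1|exact: cV1|exact: cU2|exact: cV2].
Qed.

(** The theorem of Poincare and Bohl: adding the angle between the curves to a
    determination of the angle of [U] gives one for [V], and this angle takes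
    the same value at both ends. *)
Lemma winding_number_not_opposite U V k :
  continuous_pair U -> continuous_pair V ->
  U 1 = U 0 -> V 1 = V 0 -> (forall t, not_opposite (U t) (V t)) ->
  is_winding_number U k -> is_winding_number V k.
Proof.
move=> cU cV U10 V10 UV [th [cth Uth thk]].
exists (fun t => th t + angle_between (U t) (V t)); split.
- by move=> t; apply: cvgD; [exact: cth|exact: angle_between_continuous].
- move=> t; have [rho rho0 Ut] := Uth t.
  by have := UV t; rewrite Ut; exact: angle_betweenP.
- by rewrite U10 V10 opprD addrACA subrr addr0.
Qed.

Lemma winding_number_opp U k : is_winding_number U k ->
  is_winding_number (fun t => (- (U t).1, - (U t).2)) k.
Proof.
move=> [th [cth Uth thk]]; exists (fun t => th t + pi); split.
- by move=> t; apply: cvgD; [exact: cth|exact: cvg_cst].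
- move=> t; have [rho rho0 ->] := Uth t; exists rho => //.
  by rewrite cosDpi sinDpi !mulrN.
- by rewrite opprD addrACA subrr addr0.
Qed.

Lemma winding_number_neq0 U k t : is_winding_number U k -> U t <> (0, 0).
Proof.
move=> [th [_ Uth _]]; have [rho rho0 ->] := Uth t => -[].
move=> /eqP + /eqP; rewrite !mulf_eq0 (gt_eqF rho0) /= => /eqP c0 /eqP s0.
by have /eqP := cos2Dsin2 (th t); rewrite c0 s0 expr0n addr0 eq_sym oner_eq0.
Qed.

Lemma same_sign_not_opposite u v :
  u <> (0, 0) -> v <> (0, 0) ->
  (exists2 l, 0 < l & v.2 = l * u.2) -> (u.2 = 0 -> 0 <= u.1 * v.1) ->
  not_opposite u v.
Proof.
case: u v => u1 u2 [v1 v2] /= u0 v0 [l l0 vu] h.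
rewrite /not_opposite /=.
have norm0 (x y : R) : (x, y) <> (0, 0) -> 0 < Num.sqrt (x ^+ 2 + y ^+ 2).
  move=> xy; rewrite sqrtr_gt0 lt_neqAle addr_ge0 ?sqr_ge0 // andbT eq_sym.
  rewrite paddr_eq0 ?sqr_ge0 // !sqrf_eq0; apply/negP => /andP[/eqP x0 /eqP y0].
  by apply: xy; rewrite x0 y0.
have [u20|u20] := eqVneq u2 0.
  by rewrite ltr_pwDl ?mulr_gt0 ?norm0 // u20 mul0r addr0 h.
have u22 : 0 < u2 * v2 by rewrite vu mulrCA mulr_gt0 // -expr2 exprn_even_gt0.
have le1 (x y : R) : `|x| <= Num.sqrt (x ^+ 2 + y ^+ 2).
  by rewrite -sqrtr_sqr ler_sqrt ?lerDl ?addr_ge0 ?sqr_ge0.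
have : `|u1 * v1| <=
    Num.sqrt (u1 ^+ 2 + u2 ^+ 2) * Num.sqrt (v1 ^+ 2 + v2 ^+ 2).
  by rewrite normrM ler_pM.
by rewrite ler_norml => /andP[]; lra.
Qed.

End winding.

(** * Continuity of the frames and of the matrix of the map *)

Section entrywise_convergence.
Variables (R : realType) (T : Type) (F : set_system T).
Context {FF : Filter F}.
Implicit Types (A : T -> 'M[R]_2) (B : 'M[R]_2).

(** Entrywise convergence is the form in which products and inverses of matrices
    of order two are handled. *)
Definition mxcvg A B : Prop := forall i j, A t i j @[t --> F] --> B i j.

Lemma mxcvg_cvg A B : mxcvg A B -> A t @[t --> F] --> B.
Proof.
move=> AB; apply/cvgrPdist_le => e e0.
have : \forall t \near F, forall ij : 'I_2 * 'I_2,
    `|B ij.1 ij.2 - A t ij.1 ij.2| <= e.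
  by apply: filter_forall => -[i j] /=; move/cvgrPdist_le: (AB i j); exact.
apply: filterS => t h; apply: normr_mx_le; first exact: ltW.
by move=> i j; rewrite !mxE; exact: (h (i, j)).
Qed.

Lemma cvg_mxcvg A B : A t @[t --> F] --> B -> mxcvg A B.
Proof.
move=> AB i j; apply/cvgrPdist_le => e e0.
move/cvgrPdist_le: AB => /(_ _ e0); apply: filterS => t h.
by apply: le_trans h; have := normr_entry_le (B - A t) i j; rewrite !mxE.
Qed.

Lemma mxcvg_cst B : mxcvg (fun=> B) B.
Proof. by move=> i j; exact: cvg_cst. Qed.

Lemma mxcvg_near A1 A2 B : (\forall t \near F, A1 t = A2 t) ->
  mxcvg A1 B -> mxcvg A2 B.
Proof.
move=> A12 h i j; apply: cvg_trans (h i j); apply: near_eq_cvg.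
by apply: filterS A12 => t ->.
Qed.

Lemma mxcvg_mul A1 A2 B1 B2 : mxcvg A1 B1 -> mxcvg A2 B2 ->
  mxcvg (fun t => A1 t *m A2 t) (B1 *m B2).
Proof.
move=> h1 h2 i j; under eq_cvg do rewrite mul2E.
by rewrite mul2E; apply: cvgD; apply: cvgM; first [exact: h1|exact: h2].
Qed.

Lemma mxcvg_inv A B : (\forall t \near F, A t \in unitmx) -> B \in unitmx ->
  mxcvg A B -> mxcvg (fun t => invmx (A t)) (invmx B).
Proof.
move=> uA uB AB.
have cd : \det (A t) @[t --> F] --> \det B.
  under eq_cvg do rewrite det2E.
  by rewrite det2E; apply: cvgB; apply: cvgM; exact: AB.
have cdV : (\det (A t))^-1 @[t --> F] --> (\det B)^-1.
  by apply: cvgV => //; rewrite -unitfE -unitmxE.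
apply: (@mxcvg_near (fun t => mx22
    (A t 1 1 / \det (A t)) (- A t 0 1 / \det (A t))
    (- A t 1 0 / \det (A t)) (A t 0 0 / \det (A t)))).
  by apply: filterS uA => t /invmx2E.
rewrite (invmx2E uB) => i j.
under eq_cvg do rewrite mxE.
by rewrite mxE; case: (i == 0); case: (j == 0); apply: cvgM => //;
  do ?apply: cvgN; exact: AB.
Qed.

End entrywise_convergence.

Lemma continuous_cvg_filter (T U : topologicalType) (f : T -> U) z
    (F : set_system T) : F --> z -> {for z, continuous f} -> f @ F --> f z.
Proof. by move=> Fz cf A /cf; exact: Fz. Qed.

Section boundary_frames.
Variables (R : realType) (S : oriented_surface R).
Variables (g : S -> 'M[R]_2) (P : S -> 'M[R]_2).
Hypothesis metric_g : riemannian_metric g.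
Hypothesis P_adapted : forall p, boundary p -> adapted_frame (g p) (P p).
Implicit Types (phi psi : chart R S) (p z : S) (FF : set_system S).

Let chart_frame phi z := to_chart phi z *m P z.

Let chart_frame_adapted phi z : atlas phi -> chart_dom phi z -> boundary z ->
  adapted_frame (form_in_chart g phi z) (chart_frame phi z).
Proof.
by move=> aphi dz bz; apply: adapted_frame_to_chart => //; exact: P_adapted.
Qed.

(** The frame [P] is unrelated at neighbouring points, but its expression in a
    fixed chart is a continuous function of the Gram matrix of [g] there.  The
    filter [FF] stands for neighbourhoods of [z0] within the boundary as well as
    for the image of a neighbourhood under a parametrization. *)
Lemma chart_frame_cvg phi z0 FF : Filter FF -> FF --> z0 ->
  (\forall z \near FF, boundary z) -> boundary z0 ->
  atlas phi -> chart_dom phi z0 ->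
  mxcvg FF (chart_frame phi) (chart_frame phi z0).
Proof.
move=> fFF cFF bFF bz0 aphi dz0; have [_ _ sg] := metric_g.
pose h := form_in_chart g phi.
have ch i j : h z i j @[z --> FF] --> h z0 i j.
  apply: (@continuous_cvg_filter _ _ (fun z => h z i j) z0 FF cFF).
  exact: form_in_chart_continuous (sg _ aphi) dz0.
have nE : \forall z \near FF, adapted_frame (h z) (chart_frame phi z).
  by apply: filterS2 bFF (cFF _ (nbhs_chart_dom dz0)) => z bz dz;
    exact: chart_frame_adapted.
have E0 := chart_frame_adapted aphi dz0 bz0.
have [h11 hd [E00 E11 E10]] := adapted_frame_entries E0.
have [E01 _ _ _] := E0.
have c00 : (Num.sqrt (h z 0 0 - h z 0 1 ^+ 2 / h z 1 1))^-1 @[z --> FF] -->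
    chart_frame phi z0 0 0.
  rewrite E00; apply: cvgV; first by rewrite gt_eqF // sqrtr_gt0.
  apply: (@cvg_comp _ _ _ (fun z => h z 0 0 - h z 0 1 ^+ 2 / h z 1 1) Num.sqrt);
    last exact: sqrt_continuous.
  apply: cvgB => //; apply: cvgM; first by apply: cvgM.
  by apply: cvgV => //; rewrite gt_eqF.
have c11 : (Num.sqrt (h z 1 1))^-1 @[z --> FF] --> chart_frame phi z0 1 1.
  rewrite E11; apply: cvgV; first by rewrite gt_eqF // sqrtr_gt0.
  apply: (@cvg_comp _ _ _ (fun z => h z 1 1) Num.sqrt); first exact: ch.
  exact: sqrt_continuous.
have c10 : - h z 0 1 / h z 1 1 *
    (Num.sqrt (h z 0 0 - h z 0 1 ^+ 2 / h z 1 1))^-1 @[z --> FF] -->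
    chart_frame phi z0 1 0.
  rewrite E10; apply: cvgM => //; apply: cvgM; first exact: cvgN.
  by apply: cvgV => //; rewrite gt_eqF.
apply: (@mxcvg_near _ _ _ _ (fun z => mx22
  (Num.sqrt (h z 0 0 - h z 0 1 ^+ 2 / h z 1 1))^-1 0
  (- h z 0 1 / h z 1 1 * (Num.sqrt (h z 0 0 - h z 0 1 ^+ 2 / h z 1 1))^-1)
  (Num.sqrt (h z 1 1))^-1)).
  apply: filterS nE => z Ez; have [e01 _ _ _] := Ez.
  have [_ _ [e00 e11 e10]] := adapted_frame_entries Ez.
  apply: eq_mx22; rewrite [LHS]mxE /=.
  - by rewrite -e00.
  - by rewrite -e01.
  - by rewrite -e00 -e10.
  - by rewrite -e11.
move=> i j; under eq_cvg do rewrite mxE.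
have [->|->] := ord2P i; have [->|->] := ord2P j => //=.
by rewrite E01; exact: cvg_cst.
Qed.

Let chart_frame_unit phi z : atlas phi -> chart_dom phi z -> boundary z ->
  chart_frame phi z \in unitmx.
Proof.
by move=> aphi dz bz; apply: adapted_frame_unit (chart_frame_adapted _ _ _).
Qed.

Lemma chart_frame_inv_cvg phi z0 FF : Filter FF -> FF --> z0 ->
  (\forall z \near FF, boundary z) -> boundary z0 ->
  atlas phi -> chart_dom phi z0 ->
  mxcvg FF (fun z => invmx (chart_frame phi z)) (invmx (chart_frame phi z0)).
Proof.
move=> fFF cFF bFF bz0 aphi dz0; apply: mxcvg_inv; last exact: chart_frame_cvg.
  by apply: filterS2 bFF (cFF _ (nbhs_chart_dom dz0)) => z bz dz;
    exact: chart_frame_unit.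
exact: chart_frame_unit.
Qed.

Lemma frame_tangent_map_cvg (F : S -> S) z0 FF : Filter FF -> FF --> z0 ->
  smooth_map F ->
  (\forall z \near FF, boundary z /\ boundary (F z)) ->
  boundary z0 -> boundary (F z0) ->
  mxcvg FF (fun z => invmx (P (F z)) *m tangent_map F z *m P z)
           (invmx (P (F z0)) *m tangent_map F z0 *m P z0).
Proof.
move=> fFF cFF sF bFF bz0 bFz0; have cF := sF.1.
pose phi := chart_at z0; pose psi := chart_at (F z0).
have aphi : atlas phi := chart_at_atlas z0.
have apsi : atlas psi := chart_at_atlas (F z0).
have dphi : chart_dom phi z0 := chart_at_dom z0.
have dpsi : chart_dom psi (F z0) := chart_at_dom (F z0).
pose D z := hdiff (psi \o F \o chart_inv phi) (phi z).
have eqn z : chart_dom phi z -> chart_dom psi (F z) -> boundary z ->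
    boundary (F z) ->
    invmx (chart_frame psi (F z)) *m D z *m chart_frame phi z =
    invmx (P (F z)) *m tangent_map F z *m P z.
  move=> dz dFz bz bFz; apply: frame_change_map.
  - exact: to_chart_unit apsi dFz.
  - exact: adapted_frame_unit (P_adapted bFz).
  - exact: to_chart_tangent_map.
have cD : mxcvg FF D (D z0).
  move=> i j; apply: (continuous_cvg_filter cFF).
  exact: chart_hdiff_continuous.
have cFF' : F @ FF --> F z0 := continuous_cvg_filter cFF (cF z0).
have bF : \forall z \near F @ FF, boundary z by apply: filterS bFF => z [].
have bFF1 : \forall z \near FF, boundary z by apply: filterS bFF => z [].
have cI : mxcvg FF (fun z => invmx (chart_frame psi (F z)))
    (invmx (chart_frame psi (F z0))).
  exact: (chart_frame_inv_cvg _ cFF' bF bFz0 apsi dpsi).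
have cE := chart_frame_cvg fFF cFF bFF1 bz0 aphi dphi.
rewrite -eqn //; apply: mxcvg_near (mxcvg_mul (mxcvg_mul cI cD) cE).
apply: filterS3 bFF (cFF _ (nbhs_chart_dom dphi))
  (cFF' _ (nbhs_chart_dom dpsi)).
by move=> z [bz bFz] dz dFz; exact: eqn.
Qed.

Definition conj_frame (A : S -> 'M[R]_2) z := invmx (P z) *m A z *m P z.

(** Regularity of endomorphism fields is defined in the charts of the atlas; the
    continuity of the frames translates it into continuity of the entries of
    their matrices with respect to the frame. *)
Lemma conj_frame_cvg (A : S -> 'M[R]_2) z0 FF phi :
  Filter FF -> FF --> z0 ->
  (\forall z \near FF, boundary z) -> boundary z0 ->
  atlas phi -> chart_dom phi z0 ->
  mxcvg FF (endo_in_chart A phi) (endo_in_chart A phi z0) <->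
  mxcvg FF (conj_frame A) (conj_frame A z0).
Proof.
move=> fFF cFF bFF bz0 aphi dz0.
have c1 := chart_frame_cvg fFF cFF bFF bz0 aphi dz0.
have c2 := chart_frame_inv_cvg fFF cFF bFF bz0 aphi dz0.
have e1 z : boundary z -> chart_dom phi z ->
    invmx (chart_frame phi z) *m endo_in_chart A phi z *m chart_frame phi z =
    conj_frame A z.
  move=> bz dz; rewrite /endo_in_chart /conj_frame /chart_frame.
  have uT := to_chart_unit aphi dz.
  have uE := chart_frame_unit aphi dz bz.
  have uP : P z \in unitmx by apply: adapted_frame_unit (P_adapted bz).
  apply: (can_inj (mulKmx uE)); rewrite !mulmxA mulmxV // mul1mx /chart_frame.
  by rewrite (mulmxK uP) -[_ *m invmx _ *m _]mulmxA mulVmx // mulmx1.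
have e2 z : boundary z -> chart_dom phi z ->
    chart_frame phi z *m conj_frame A z *m invmx (chart_frame phi z) =
    endo_in_chart A phi z.
  move=> bz dz; have uE := chart_frame_unit aphi dz bz.
  rewrite -e1 //; move: (chart_frame phi z) uE => E uE.
  by rewrite !mulmxA mulmxV // mul1mx mulmxK.
have nd := cFF _ (nbhs_chart_dom dz0).
split=> cA.
  rewrite -e1 //; apply: mxcvg_near (mxcvg_mul (mxcvg_mul c2 cA) c1).
  by apply: filterS2 bFF nd; exact: e1.
rewrite -e2 //; apply: mxcvg_near (mxcvg_mul (mxcvg_mul c1 cA) c2).
by apply: filterS2 bFF nd; exact: e2.
Qed.

End boundary_frames.

(** * Trace-free symmetric endomorphisms at a boundary point *)

Section trace_free_symmetric.
Variables (R : realType) (S : oriented_surface R).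
Variables (g : S -> 'M[R]_2) (p : S) (P : 'M[R]_2).
Hypothesis P_adapted : adapted_frame (g p) P.
Implicit Types A B : 'M[R]_2.

Let PgP : P^T *m g p *m P = 1%:M. Proof. by case: P_adapted. Qed.
Let uP : P \in unitmx := adapted_frame_unit P_adapted.

Let conj A := invmx P *m A *m P.

Lemma metric_frame : g p = (invmx P)^T *m invmx P.
Proof.
have uPt : P^T \in unitmx by rewrite unitmx_tr.
apply: (can_inj (mulmxK uP)); rewrite mulmxKV //.
apply: (can_inj (mulKmx uPt)).
by rewrite mulmxA PgP -trmx_mul mulVmx // trmx1.
Qed.

Lemma invmx_metric_frame : invmx (g p) = P *m P^T.
Proof.
have ug : g p \in unitmx.
  by rewrite metric_frame unitmx_mul unitmx_tr unitmx_inv uP.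
apply: (can_inj (mulKmx ug)); rewrite mulmxV // metric_frame.
rewrite -!mulmxA (mulmxA (invmx P)) mulVmx // mul1mx.
by rewrite -trmx_mul mulmxV // trmx1.
Qed.

Lemma mxtrace_conj A : \tr A = conj A 0 0 + conj A 1 1.
Proof.
rewrite -[LHS](_ : \tr (conj A) = _); last first.
  by rewrite /conj -mulmxA mxtrace_mulC -mulmxA mulmxV // mulmx1.
rewrite /mxtrace big_ord_recl big_ord1 (_ : lift ord0 ord0 = 1) //.
exact/val_inj.
Qed.

(** In an orthonormal frame the adjoint of an endomorphism is the transpose. *)
Lemma in_EaP A : in_Ea g p A <->
  conj A 1 0 = conj A 0 1 /\ conj A 1 1 = - conj A 0 0.
Proof.
have trE := mxtrace_conj A.
have symE : (forall u v, bilin g p (A *m u) v = bilin g p u (A *m v)) <->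
    (conj A)^T = conj A.
  have -> : (forall u v, bilin g p (A *m u) v = bilin g p u (A *m v)) <->
      A^T *m g p = g p *m A.
    split=> [h|h u v]; last first.
      by rewrite /bilin trmx_mul -!mulmxA (mulmxA A^T) h !mulmxA.
    apply/matrixP => i j.
    have entry (M : 'M[R]_2) :
        ((delta_mx i 0 : 'cV_2)^T *m M *m (delta_mx j 0 : 'cV_2)) 0 0 = M i j.
      by rewrite trmx_delta -rowE -colE !mxE.
    rewrite -(entry (A^T *m g p)) -(entry (g p *m A)).
    by have := h (delta_mx i 0) (delta_mx j 0); rewrite /bilin trmx_mul !mulmxA.
  have gP : g p *m P = (invmx P)^T by rewrite metric_frame mulmxKV.
  have Pg : P^T *m g p = invmx P.
    by rewrite metric_frame mulmxA -trmx_mul mulVmx // trmx1 mul1mx.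
  have hT : (conj A)^T = P^T *m (A^T *m g p) *m P.
    by rewrite /conj !trmx_mul -gP !mulmxA.
  have hN : conj A = P^T *m (g p *m A) *m P by rewrite /conj -Pg !mulmxA.
  rewrite hT hN; split=> [->//|h].
  have uPt : P^T \in unitmx by rewrite unitmx_tr.
  exact: (can_inj (mulKmx uPt) (can_inj (mulmxK uP) h)).
rewrite /in_Ea symE trE; split=> [[/matrixP/(_ 0 1)]|[h1 h2]].
  by rewrite mxE => -> /eqP; rewrite addr_eq0 => /eqP ->; rewrite opprK.
by split; [apply: eq_mx22; rewrite mxE|rewrite h2 subrr].
Qed.

Lemma conj_reflection : conj (boundary_reflection g p) = mx22 (-1) 0 0 1.
Proof.
have [P01 P00 P11 _] := P_adapted.
rewrite /conj /boundary_reflection; set v := delta_mx 1 0.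
have Pv : P *m v = P 1 1 *: v.
  apply/matrixP => i j; rewrite mul2E !mxE (ord1 j).
  by have [->|->] := ord2P i; rewrite /= ?P01; ring.
have P11' : P 1 1 != 0 by rewrite gt_eqF.
have vE : v = (P 1 1)^-1 *: (P *m v) by rewrite Pv scalerA mulVf // scale1r.
have vgP : v^T *m g p *m P = (P 1 1)^-1 *: v^T.
  rewrite [v in LHS]vE linearZ /= -!scalemxAl trmx_mul -!mulmxA.
  by rewrite (mulmxA P^T) PgP mulmx1.
have vgv : bilin g p v v = (P 1 1)^-2.
  rewrite /bilin [X in _ *m X]vE -scalemxAr mulmxA vgP -scalemxAl scalerA.
  by rewrite -invfM -expr2 !mxE big_ord_recl big_ord1 !mxE /=; ring.
apply: (can_inj (mulKmx uP)); rewrite -!mulmxA mulKVmx // mulmxBl mul1mx.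
rewrite -scalemxAl -!mulmxA (mulmxA v^T) vgP -scalemxAr scalerA vgv.
have -> : 2 / (P 1 1)^-2 * (P 1 1)^-1 = 2 * P 1 1 by field.
rewrite /v trmx_delta mul_delta_mx.
by apply: eq_mx22; rewrite [RHS]mul2E !mxE /= ?P01; ring.
Qed.

(** Minus the reflection that exchanges the two vectors of the frame.  The sign
    is forced by the orientation: the reflection along the boundary has the
    coordinates [(-1, 0)], so a positive complement needs a negative second
    coordinate. *)
Definition reflection_complement : 'M[R]_2 :=
  P *m mx22 0 (-1) (-1) 0 *m invmx P.

Lemma conj_complement : conj reflection_complement = mx22 0 (-1) (-1) 0.
Proof.
by rewrite /conj /reflection_complement !mulmxA mulVmx // mul1mx mulmxKV.
Qed.

Lemma conj_inj A B : conj A = conj B -> A = B.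
Proof.
move=> /(congr1 (fun M => P *m M *m invmx P)).
by rewrite /conj !mulmxA !mulmxV // !mul1mx !mulmxK.
Qed.

(** Passing to another positive orthonormal basis rotates the coordinates of
    [E^a] by minus twice the angle, which preserves their oriented area. *)
Lemma reflection_complement_positive :
  Ea_positive_basis g p (boundary_reflection g p) reflection_complement.
Proof.
split.
- by apply/in_EaP; rewrite conj_reflection !mxE /= opprK.
- by apply/in_EaP; rewrite conj_complement !mxE /= oppr0.
move=> e [ege dete].
pose Q := invmx P *m e.
have QQ : Q^T *m Q = 1%:M.
  by rewrite -ege metric_frame /Q trmx_mul !mulmxA.
have detQ : 0 < \det Q.
  rewrite det_mulmx det_inv mulr_gt0 // invr_gt0.
  have [P01 P00 P11 _] := P_adapted.
  by rewrite det2E P01 mul0r subr0 mulr_gt0.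
have ue : e \in unitmx by rewrite unitmxE unitfE gt_eqF.
have eE : e = P *m Q by rewrite /Q mulKVmx.
have coordsE A : invmx e *m A *m e = Q^T *m conj A *m Q.
  apply: (can_inj (mulKmx ue)); rewrite -!mulmxA mulKVmx //.
  have eQ : e *m Q^T = P by rewrite {1}eE -mulmxA (mulmx1C QQ) mulmx1.
  by rewrite (mulmxA e Q^T) eQ mulKVmx // -eE.
clearbody Q; rewrite /Ea_coords !coordsE conj_reflection conj_complement /=.
rewrite !mul2E !mxE /=.
have q00 := congr1 (fun M : 'M[R]_2 => M 0 0) QQ.
move: q00 detQ; rewrite mul2E !mxE /= mulr1n det2E => q00 detQ.
rewrite [X in 0 < X](_ : _ =
  (Q 0 0 ^+ 2 + Q 1 0 ^+ 2) * (Q 0 0 * Q 1 1 - Q 0 1 * Q 1 0)); last by ring.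
by rewrite !expr2 q00 mul1r.
Qed.

End trace_free_symmetric.

(** * Components of the section along the boundary *)

(** In an orthonormal frame the endomorphism [H] and the form [h] have the same
    matrix [N]. *)
Lemma conj_Ha (R : realType) (S : oriented_surface R) (g h : S -> 'M[R]_2) p
    (P N : 'M[R]_2) : adapted_frame (g p) P ->
  P^T *m h p *m P = N ->
  invmx P *m Ha g h p *m P = N - ((N 0 0 + N 1 1) / 2)%:M.
Proof.
move=> aP PhP; have uP := adapted_frame_unit aP.
have sharpE : invmx P *m sharp g h p *m P = N.
  by rewrite /sharp (invmx_metric_frame aP) -PhP !mulmxA mulVmx // mul1mx.
rewrite /Ha (mxtrace_conj aP) sharpE mulmxBr mulmxBl sharpE.
by rewrite -scalemx1 -scalemxAr mulmx1 -scalemxAl mulVmx.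
Qed.

Section boundary_curve.
Variables (R : realType) (S : oriented_surface R).
Variables (g : S -> 'M[R]_2) (P : S -> 'M[R]_2) (F : S -> S) (C : set S).
Variables (a b c : S -> R).
Hypothesis metric_g : riemannian_metric g.
Hypothesis P_adapted : forall p, boundary p -> adapted_frame (g p) (P p).
Hypothesis smooth_F : smooth_map F.
Hypothesis C_boundary : C `<=` @boundary R S.
Hypothesis FC_boundary : forall z, C z -> boundary (F z).
Hypothesis ac_gt0 : forall z, C z -> 0 < a z /\ 0 < c z.
Hypothesis dF_frame : forall z, C z ->
  tangent_map F z *m P z = P (F z) *m (c z *: mx22 (a z) 0 (b z) 1).

Let M z := invmx (P (F z)) *m tangent_map F z *m P z.

Let ME z : C z -> M z = c z *: mx22 (a z) 0 (b z) 1.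
Proof.
move=> Cz; rewrite /M -mulmxA dF_frame // mulKmx //.
exact/adapted_frame_unit/P_adapted/FC_boundary.
Qed.

Let h := pullback F g.

Lemma conj_Ha_pullback z : C z -> conj_frame P (Ha g h) z =
  mx22 (c z ^+ 2 * ((a z ^+ 2 + b z ^+ 2 - 1) / 2)) (c z ^+ 2 * b z)
       (c z ^+ 2 * b z) (- (c z ^+ 2 * ((a z ^+ 2 + b z ^+ 2 - 1) / 2))).
Proof.
move=> Cz; set N := c z *: mx22 (a z) 0 (b z) 1.
have [_ _ _ PgP] := P_adapted (FC_boundary Cz).
have PhP : (P z)^T *m h z *m P z = N^T *m N.
  rewrite /h /pullback -!mulmxA dF_frame // -/N !mulmxA -trmx_mul dF_frame //.
  by rewrite -/N trmx_mul -!(mulmxA N^T) PgP mul1mx.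
rewrite /conj_frame (conj_Ha (P_adapted (C_boundary Cz)) PhP).
by apply: eq_mx22; rewrite !mxE /= !big_ord_recl !big_ord0 !mxE /=; field.
Qed.

Variable gamma : R -> S.
Hypothesis gamma_continuous : continuous gamma.
Hypothesis gamma_C : forall t, C (gamma t).
Hypothesis gamma_periodic : gamma 1 = gamma 0.

Let gamma_boundary t : boundary (gamma t). Proof. exact: C_boundary. Qed.

Let near_gamma (t : R) (Q : set S) : (forall s, Q (gamma s)) ->
  \forall z \near gamma x @[x --> t], Q z.
Proof. by move=> hQ; exact: (@filterE _ (nbhs t) _ _ hQ). Qed.

Lemma frame_matrix_continuous i j : continuous (fun t => M (gamma t) i j).
Proof.
move=> t; apply: (@frame_tangent_map_cvg _ _ g P metric_g P_adapted F (gamma t)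
  (gamma x @[x --> t]) _ (gamma_continuous (x := t)) smooth_F) => //.
- exact: fmap_filter.
- by apply: near_gamma => s; split; [exact: gamma_boundary|exact: FC_boundary].
- exact: FC_boundary.
Qed.

Let c_continuous : continuous (c \o gamma).
Proof.
rewrite (_ : c \o gamma = fun t => M (gamma t) 1 1).
  exact: frame_matrix_continuous.
by apply/funext => t; rewrite ME // !mxE /= mulr1.
Qed.

Let a_continuous : continuous (a \o gamma).
Proof.
rewrite (_ : a \o gamma = fun t => M (gamma t) 0 0 / c (gamma t)).
  move=> t; apply: cvgM; first exact: frame_matrix_continuous.
  apply: cvgV; last exact: c_continuous.
  by have [_ c0] := ac_gt0 (gamma_C t); rewrite gt_eqF.
apply/funext => t; rewrite ME // !mxE /= mulrC mulKf //.
by have [_ c0] := ac_gt0 (gamma_C t); rewrite gt_eqF.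
Qed.

Let b_continuous : continuous (b \o gamma).
Proof.
rewrite (_ : b \o gamma = fun t => M (gamma t) 1 0 / c (gamma t)).
  move=> t; apply: cvgM; first exact: frame_matrix_continuous.
  apply: cvgV; last exact: c_continuous.
  by have [_ c0] := ac_gt0 (gamma_C t); rewrite gt_eqF.
apply/funext => t; rewrite ME // !mxE /= mulrC mulKf //.
by have [_ c0] := ac_gt0 (gamma_C t); rewrite gt_eqF.
Qed.

Lemma conj_frame_continuous (r : S -> 'M[R]_2) i j :
  continuous_endo_along C r ->
  continuous (fun t => conj_frame P r (gamma t) i j).
Proof.
move=> cr t; pose phi := chart_at (gamma t).
have aphi : atlas phi := chart_at_atlas _.
have dphi : chart_dom phi (gamma t) := chart_at_dom _.
have cvg_endo : endo_in_chart r phi z @[z --> gamma x @[x --> t]] -->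
    endo_in_chart r phi (gamma t).
  have /subspace_continuousP /(_ _ (conj (gamma_C t) dphi)) := cr _ aphi.
  apply: cvg_trans; apply: cvg_app => A nA.
  have nA' : \forall s \near t, (C `&` chart_dom phi) (gamma s) -> A (gamma s).
    exact: (gamma_continuous nA).
  have nd : \forall s \near t, chart_dom phi (gamma s).
    exact: (gamma_continuous (nbhs_chart_dom dphi)).
  by apply: filterS2 nA' nd => s As ds; exact: As.
have bF : \forall z \near gamma x @[x --> t], boundary z.
  exact: near_gamma.
have fF : Filter (gamma x @[x --> t]) by exact: fmap_filter.
have [h1 _] := @conj_frame_cvg _ _ g P metric_g P_adapted r (gamma t)
  (gamma x @[x --> t]) phi fF (gamma_continuous (x := t)) bF (gamma_boundary t)
  aphi dphi.
exact: (h1 (cvg_mxcvg cvg_endo) i j).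
Qed.

(** Let [(al, be)] be the coordinates of [r'] in the frame; [be < 0] since
    [(R, r')] is positive.  Comparing coordinates gives [y = c^2 b / be] and
    [x = al y - c^2 (a^2 + b^2 - 1) / 2], so that [- (x, y)] and [(a - 1, b)]
    have second coordinates of the same sign and, where these vanish, first
    coordinates of the same sign. *)
Lemma winding_components (r' : S -> 'M[R]_2) (x y : S -> R) k :
  continuous_endo_along C r' ->
  (forall p, C p -> Ea_positive_basis g p (boundary_reflection g p) (r' p)) ->
  (forall p, C p -> Ha g h p = x p *: boundary_reflection g p + y p *: r' p) ->
  is_winding_number ((fun p => (x p, y p)) \o gamma) k <->
  is_winding_number ((fun p => (a p - 1, b p)) \o gamma) k.
Proof.
move=> cr' pos HaE.
pose al t := conj_frame P r' (gamma t) 0 0.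
pose be t := conj_frame P r' (gamma t) 0 1.
pose c2 t := c (gamma t) ^+ 2.
pose A t := a (gamma t); pose B t := b (gamma t).
have Pad t := P_adapted (gamma_boundary t).
have c0 t : 0 < c2 t by have [_ ?] := ac_gt0 (gamma_C t); rewrite exprn_gt0.
have A0 t : 0 < A t by have [] := ac_gt0 (gamma_C t).
have be0 t : be t < 0.
  have [_ _ /(_ (P (gamma t)))] := pos _ (gamma_C t).
  have onb : positive_onb g (gamma t) (P (gamma t)).
    have [P01 P00 P11 PgP] := Pad t.
    by split=> //; rewrite det2E P01 mul0r subr0 mulr_gt0.
  move=> /(_ onb); rewrite /Ea_coords (conj_reflection (Pad t)) /=.
  by rewrite ![mx22 _ _ _ _ _ _]mxE /= mul0r subr0 mulN1r oppr_gt0.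
have cE t : conj_frame P (Ha g h) (gamma t) =
    x (gamma t) *: mx22 (-1) 0 0 1 + y (gamma t) *: conj_frame P r' (gamma t).
  rewrite /conj_frame HaE // mulmxDr mulmxDl -!scalemxAr -!scalemxAl.
  by rewrite (conj_reflection (Pad t)).
have combE (X Y : 'M[R]_2) u v i j :
    (u *: X + v *: Y) i j = u * X i j + v * Y i j by rewrite !mxE.
have yE t : y (gamma t) = c2 t * B t / be t.
  have := congr1 (fun X : 'M[R]_2 => X 0 1) (cE t).
  rewrite conj_Ha_pullback // combE ![mx22 _ _ _ _ _ _]mxE /=.
  rewrite mulr0 add0r -/(be t) /c2 /B => ->.
  by rewrite mulfK // lt_eqF.
have xE t : x (gamma t) =
    c2 t * B t / be t * al t - c2 t * ((A t ^+ 2 + B t ^+ 2 - 1) / 2).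
  have := congr1 (fun X : 'M[R]_2 => X 0 0) (cE t).
  rewrite conj_Ha_pullback // combE ![mx22 _ _ _ _ _ _]mxE /=.
  by rewrite -/(al t) -yE -/(c2 t) -/(A t) -/(B t) => ->; ring.
have cc : continuous c2 by move=> t; apply: cvgM; exact: c_continuous.
have cal : continuous al by exact: conj_frame_continuous.
have cbe : continuous be by exact: conj_frame_continuous.
have cA : continuous A by exact: a_continuous.
have cB : continuous B by exact: b_continuous.
pose U t := (A t - 1, B t); pose V t := (- x (gamma t), - y (gamma t)).
have cy : continuous (y \o gamma).
  rewrite (_ : y \o gamma = fun t => c2 t * B t / be t); last exact/funext.
  move=> t; apply: cvgM; first by apply: cvgM; [exact: cc|exact: cB].
  by apply: cvgV; [rewrite lt_eqF|exact: cbe].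
have cx : continuous (x \o gamma).
  rewrite (_ : x \o gamma = fun t => y (gamma t) * al t -
    c2 t * ((A t * A t + B t * B t - 1) / 2)); last first.
    by apply/funext => t; rewrite /= xE yE !expr2.
  move=> t; apply: cvgB; first by apply: cvgM; [exact: cy|exact: cal].
  apply: cvgM; first exact: cc.
  apply: cvgM; last exact: cvg_cst.
  apply: cvgB; last exact: cvg_cst.
  by apply: cvgD; apply: cvgM; first [exact: cA|exact: cB].
have cU : continuous_pair U.
  split=> [t|]; last exact: cB.
  by apply: cvgB; [exact: cA|exact: cvg_cst].
have cV : continuous_pair V.
  by split=> t; apply: cvgN; [exact: cx|exact: cy].
(* Without its value, c2 is not split as a square by mulf_eq0 below. *)
clearbody c2.
have UV t : U t <> (0, 0) <-> V t <> (0, 0).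
  rewrite /U /V; split=> + [].
    move=> U0 /eqP; rewrite oppr_eq0 => /eqP x0.
    move=> /eqP; rewrite oppr_eq0 => /eqP y0.
    apply: U0.
    have B0 : B t = 0.
      have /eqP := yE t; rewrite y0 eq_sym !mulf_eq0 invr_eq0 (gt_eqF (c0 t)).
      by rewrite (lt_eqF (be0 t)) orbF /= => /eqP.
    have := xE t; rewrite x0 B0 mulr0 !mul0r expr0n /= addr0 sub0r => /eqP.
    rewrite eq_sym oppr_eq0 mulf_eq0 (gt_eqF (c0 t)) /= mulf_eq0 invr_eq0.
    rewrite pnatr_eq0 orbF subr_eq0 sqrp_eq1 ?ltW // => /eqP ->.
    by rewrite subrr.
  move=> V0 A1 B0; apply: V0.
  have {}A1 : A t = 1 by apply/eqP; rewrite -subr_eq0 A1.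
  rewrite xE yE B0 A1 mulr0 !mul0r expr1n expr0n /= addr0.
  by rewrite subrr mul0r mulr0 subrr oppr0.
have op t : U t <> (0, 0) -> not_opposite (U t) (V t).
  move=> U0; apply: same_sign_not_opposite => //; first exact/UV.
    exists (c2 t / - be t); first by rewrite divr_gt0 // oppr_gt0.
    by rewrite /= yE invrN; ring.
  move=> /= B0; rewrite xE B0 mulr0 !mul0r sub0r opprK expr0n /= addr0.
  rewrite (_ : _ * _ = c2 t * (A t - 1) ^+ 2 * ((A t + 1) / 2)); last by field.
  apply: mulr_ge0; first by rewrite mulr_ge0 ?sqr_ge0 // ltW.
  by rewrite divr_ge0 // addr_ge0 // ltW.
have U10 : U 1 = U 0 by rewrite /U /A /B gamma_periodic.
have V10 : V 1 = V 0 by rewrite /V gamma_periodic.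
split=> hk.
  have hV : is_winding_number V k by exact: winding_number_opp hk.
  have hU t : U t <> (0, 0) by apply/UV; exact: winding_number_neq0 hV.
  apply: (winding_number_not_opposite cV cU V10 U10 _ hV) => t.
  exact/not_opposite_sym/op.
have hV : is_winding_number V k.
  apply: (winding_number_not_opposite cU cV U10 V10 _ hk) => t.
  by apply: op; exact: (winding_number_neq0 hk).
have := winding_number_opp hV.
rewrite (_ : (fun t => _) = (fun p => (x p, y p)) \o gamma) //.
by apply/funext => t; rewrite /= !opprK.
Qed.

End boundary_curve.

Theorem theorem1p4 (R : realType) (S : oriented_surface R) (n : nat)
    (C : 'I_n -> set S) (g : S -> 'M[R]_2) (F : S -> S)
    (nu tau : S -> 'cV[R]_2) :
  compact [set: S] ->
  boundary_components C ->
  riemannian_metric g ->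
  diffeomorphism F ->
  orientation_preserving F ->
  finite_set (conformal_points g (pullback F g)) ->
  conformal_points g (pullback F g) `<=` ~` @boundary R S ->
  (forall p, boundary p -> outward_unit_normal g p (nu p)) ->
  (forall p, boundary p -> positive_unit_tangent g p (tau p)) ->
  forall (i j : 'I_n) (a b c : S -> R),
    F @` C i = C j ->
    (forall z, C i z -> 0 < a z /\ 0 < c z) ->
    (forall z, C i z ->
       tangent_map F z *m frame (nu z) (tau z) =
       frame (nu (F z)) (tau (F z)) *m (c z *: mx22 (a z) 0 (b z) 1)) ->
    w_boundary g (pullback F g) (C i) = winding (C i) (fun z => (a z - 1, b z)).
Proof.
move=> _ [_ rangeC] metric_g [sF _] _ _ _ nuP tauP i j a b c FC ac dF.
have gsym p : (g p)^T = g p by have [] := metric_g.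
have Cb l : C l `<=` @boundary R S.
  have : range C (C l) by exists l.
  by rewrite rangeC => -[p _ <-]; exact: connected_component_sub.
have FCb z : C i z -> boundary (F z).
  by move=> Cz; apply: (Cb j); rewrite -FC; exists z.
pose P z := frame (nu z) (tau z).
have Pad p : boundary p -> adapted_frame (g p) (P p).
  by move=> bp; apply: frame_adapted; [exact: nuP|exact: tauP|exact: gsym].
have param gamma : positive_parametrization (C i) gamma ->
    [/\ continuous gamma, forall t, C i (gamma t) & gamma 1 = gamma 0].
  move=> [cg _ per [_ rg] _]; split=> //.
    by move=> t; rewrite -rg; exists t.
  by rewrite -(per 0) add0r.
rewrite /w_boundary /Ea_winding /winding; congr (xget _ _).
apply/seteqP; split=> k /=.
  move=> [r' [x [y [cr' pos HaE [gamma pg wk]]]]].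
  have [cg gC per] := param _ pg.
  exists gamma => //.
  exact/(@winding_components _ _ _ _ _ _ a b c metric_g Pad sF (Cb i) FCb ac dF
    _ cg gC per _ _ _ k cr' pos HaE).
move=> [gamma pg wk]; have [cg gC per] := param _ pg.
pose r' p := reflection_complement (P p).
(* The components with respect to the complement (0, -1). *)
pose x p := - (c p ^+ 2 * ((a p ^+ 2 + b p ^+ 2 - 1) / 2)).
pose y p := - (c p ^+ 2 * b p).
have cr' : continuous_endo_along (C i) r'.
  move=> phi aphi; apply/subspace_continuousP => z [Cz dz].
  have bz := Cb i z Cz.
  pose FF := within (C i `&` chart_dom phi) (nbhs z).
  have fFF : Filter FF by exact: within_filter.
  have cFF : FF --> z by exact: cvg_within.
  have nC : \forall z \near FF, C i z.
    by apply: (@filterE _ (nbhs z)) => w [].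
  have bFF : \forall z \near FF, boundary z.
    by apply: filterS nC => w; exact: Cb.
  apply: mxcvg_cvg.
  apply/(@conj_frame_cvg R S g P metric_g Pad r' z FF phi fFF cFF bFF bz aphi
    dz).
  have r'E w : boundary w -> conj_frame P r' w = mx22 0 (-1) (-1) 0.
    by move=> bw; apply: (conj_complement (Pad w bw)).
  rewrite r'E //; apply: (@mxcvg_near _ _ FF fFF (fun=> mx22 0 (-1) (-1) 0)).
    by apply: filterS bFF => w /r'E ->.
  exact: mxcvg_cst.
have pos p : C i p -> Ea_positive_basis g p (boundary_reflection g p) (r' p).
  by move=> Cp; apply: reflection_complement_positive (Pad p (Cb i p Cp)).
have HaE p : C i p -> Ha g (pullback F g) p =
    x p *: boundary_reflection g p + y p *: r' p.
  move=> Cp; have aP := Pad p (Cb i p Cp).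
  apply: (conj_inj aP).
  have := @conj_Ha_pullback R S g P F (C i) a b c Pad (Cb i) FCb dF p Cp.
  rewrite /conj_frame => ->.
  rewrite mulmxDr mulmxDl -!scalemxAr -!scalemxAl.
  rewrite (conj_reflection aP) (conj_complement aP) /x /y.
  by apply: eq_mx22; rewrite !mxE /=; ring.
exists r', x, y; split=> //; exists gamma => //.
exact/(@winding_components _ _ _ _ _ _ a b c metric_g Pad sF (Cb i) FCb ac dF
  _ cg gC per _ _ _ k cr' pos HaE).
Qed.
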